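(* Let $(X,\{w_j\}_{j=1}^m,\{p_j\}_{j=1}^m)$ be a nonexpansive system in which at least one $w_j$ is weakly contractive, and let $K$ be its invariant set. If $$\sup_{x\in K}\ \sum_{j=1}^m p_j(x)\cdot\sup_{y\in K,\ y\neq x}\frac{|w_j(x)-w_j(y)|}{|x-y|}<\min_{x\in K}\sum_{j=1}^m p_j(x),$$ then the Ruelle operator theorem holds for this system.
   Context: Let $X\subseteq\mathbb{R}^d$ be a nonempty compact set. A map $w:X\to X$ is nonexpansive if $|w(x)-w(y)|\le|x-y|$ for all $x,y\in X$, and weakly contractive if $\sup_{x,y\in X,\,|x-y|\le t}|w(x)-w(y)|<t$ for all $t>0$. A function $p$ on $X$ is Dini continuous if $\int_0^1\frac{\alpha_p(t)}{t}\,dt<\infty$, where $\alpha_p(t)=\sup_{x,y\in X,\,|x-y|\le t}|p(x)-p(y)|$. A nonexpansive system $(X,\{w_j\}_{j=1}^m,\{p_j\}_{j=1}^m)$ consists of nonexpansive maps $w_j:X\to X$ and positive Dini continuous functions $p_j:X\to(0,\infty)$, $1\le j\le m$. If at least one $w_j$ is weakly contractive, there is a unique smallest nonempty compact set $K\subseteq X$ with $K=\bigcup_{j=1}^m w_j(K)$; this is the invariant set of the system. The Ruelle operator is $T:C(K)\to C(K)$, $Tf(x)=\sum_{j=1}^m p_j(x)f(w_j(x))$, where $C(K)$ is the space of continuous functions on $K$ with the supremum norm; $\varrho$ denotes the spectral radius of $T$. $T^*$ denotes the dual operator on the space $M(K)$ of finite Borel measures on $K$, and $\langle\mu,f\rangle=\int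 f\,d\mu$. The Ruelle operator theorem holds for the system if there exist a unique positive function $h\in C(K)$ and a unique probability measure $\mu\in M(K)$ such that $Th=\varrho h$, $T^*\mu=\varrho\mu$, $\langle\mu,h\rangle=1$, and for every $f\in C(K)$, $\varrho^{-n}T^nf$ converges to $\langle\mu,f\rangle h$ in the supremum norm. Convention: a supremum over the empty set is $0$ (relevant only if $K$ is a single point). *)

(* Defs.v *)
From HB Require Import structures.
From mathcomp Require Import all_boot all_order all_algebra.
From mathcomp Require Import all_classical all_reals all_analysis.
From mathcomp Require Import complex.

Set Implicit Arguments.
Unset Strict Implicit.
Unset Printing Implicit Defensive.

Import Order.TTheory GRing.Theory Num.Theory.
Import numFieldTopology.Exports numFieldNormedType.Exports.

Local Open Scope classical_set_scope.
Local Open Scope ring_scope.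
Local Open Scope complex_scope.

(* Maps on X (or on K) are encoded as total functions on 'rV[R]_d; only their
   values on X (or on K) are constrained, and elements of C(K) are identified
   when they agree on K. *)

(* The library norm on 'rV[R]_d is the sup norm; it induces the same topology
   as the Euclidean norm below, so compact, open and continuous are the usual
   ones. *)
Definition enorm (R : realType) (d : nat) (x : 'rV[R]_d) : R :=
  Num.sqrt (\sum_(i < d) x ord0 i ^+ 2).

(* sup of delta x y over x, y in X with |x - y| <= t, allowed to be +oo. *)
Definition modulus (R : realType) (d : nat) (X : set 'rV[R]_d)
    (delta : 'rV[R]_d -> 'rV[R]_d -> R) (t : R) : \bar R :=
  ereal_sup [set e | exists x y,
    [/\ X x, X y, enorm (x - y) <= t & e = (delta x y)%:E]].

Definition nonexpansive (R : realType) (d : nat) (X : set 'rV[R]_d)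
    (w : 'rV[R]_d -> 'rV[R]_d) : Prop :=
  forall x y, X x -> X y -> enorm (w x - w y) <= enorm (x - y).

Definition weakly_contractive (R : realType) (d : nat) (X : set 'rV[R]_d)
    (w : 'rV[R]_d -> 'rV[R]_d) : Prop :=
  forall t : R, 0 < t ->
    (modulus X (fun x y => enorm (w x - w y)%R) t < t%:E)%E.

Definition Dini_continuous (R : realType) (d : nat) (X : set 'rV[R]_d)
    (p : 'rV[R]_d -> R) : Prop :=
  (\int[@lebesgue_measure R]_(t in `]0%R, 1%R])
     (modulus X (fun x y => `|p x - p y|%R) t * (t^-1)%R%:E) < +oo)%E.

Definition nonexpansive_system (R : realType) (d m : nat) (X : set 'rV[R]_d)
    (w : 'I_m -> 'rV[R]_d -> 'rV[R]_d) (p : 'I_m -> 'rV[R]_d -> R) : Prop :=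
  [/\ X !=set0,
      compact X,
      forall j x, X x -> X (w j x),
      forall j, nonexpansive X (w j) &
      forall j, (forall x, X x -> 0 < p j x) /\ Dini_continuous X (p j)].

Definition self_similar (R : realType) (d m : nat) (X : set 'rV[R]_d)
    (w : 'I_m -> 'rV[R]_d -> 'rV[R]_d) (K : set 'rV[R]_d) : Prop :=
  [/\ K !=set0, compact K, K `<=` X & K = \bigcup_(j in [set: 'I_m]) (w j @` K)].

Definition invariant_set (R : realType) (d m : nat) (X : set 'rV[R]_d)
    (w : 'I_m -> 'rV[R]_d -> 'rV[R]_d) (K : set 'rV[R]_d) : Prop :=
  self_similar X w K /\ forall K', self_similar X w K' -> K `<=` K'.

(* sup over y in K, y <> x, of |w x - w y| / |x - y|; the library's real [sup]
   of the empty set is 0. *)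
Definition lip_at (R : realType) (d : nat) (K : set 'rV[R]_d)
    (w : 'rV[R]_d -> 'rV[R]_d) (x : 'rV[R]_d) : R :=
  sup [set enorm (w x - w y) / enorm (x - y) | y in K `\ x].

Definition ruelle (R : realType) (d m : nat)
    (w : 'I_m -> 'rV[R]_d -> 'rV[R]_d) (p : 'I_m -> 'rV[R]_d -> R)
    (f : 'rV[R]_d -> R) : 'rV[R]_d -> R :=
  fun x => \sum_(j < m) p j x * f (w j x).

Definition CK (R : realType) (d : nat) (K : set 'rV[R]_d) :
  set ('rV[R]_d -> R) := [set f | {within K, continuous f}].

Definition supnorm (R : realType) (d : nat) (K : set 'rV[R]_d)
    (f : 'rV[R]_d -> R) : R := sup [set `|f x| | x in K].

(* As usual, the spectrum of an operator T on the real Banach space C(K) is that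
   of its complexification, T (u + i v) = T u + i T v, acting on the continuous
   functions from K to R[i]. *)
Definition CKC (R : realType) (d : nat) (K : set 'rV[R]_d) :
  set ('rV[R]_d -> R[i]) :=
  [set f | CK K (fun x => complex.Re (f x)) /\ CK K (fun x => complex.Im (f x))].

Definition complexify (R : realType) (d : nat)
    (T : ('rV[R]_d -> R) -> ('rV[R]_d -> R)) (f : 'rV[R]_d -> R[i]) :
    'rV[R]_d -> R[i] :=
  fun x => T (fun y => complex.Re (f y)) x +i* T (fun y => complex.Im (f y)) x.

(* l is in the resolvent set iff l - T is a bijection of C(K); the inverse is
   then bounded by the open mapping theorem. *)
Definition resolvent_set (R : realType) (d : nat) (K : set 'rV[R]_d)
    (T : ('rV[R]_d -> R) -> ('rV[R]_d -> R)) : set R[i] :=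
  [set l | forall g, CKC K g ->
     (exists2 f, CKC K f & {in K, forall x, l * f x - complexify T f x = g x}) /\
     (forall f1 f2, CKC K f1 -> CKC K f2 ->
        {in K, forall x, l * f1 x - complexify T f1 x = g x} ->
        {in K, forall x, l * f2 x - complexify T f2 x = g x} ->
        {in K, f1 =1 f2})].

Definition spectral_radius (R : realType) (d : nat) (K : set 'rV[R]_d)
    (T : ('rV[R]_d -> R) -> ('rV[R]_d -> R)) : R :=
  sup [set Normc.normc l | l in ~` resolvent_set K T].

Notation borel_rV R d := (g_sigma_algebraType (@open 'rV[R]_d)).

Definition pairing (R : realType) (d : nat) (K : set 'rV[R]_d)
    (mu : probability (borel_rV R d) R) (f : 'rV[R]_d -> R) : R :=
  \int[mu]_(x in K) f x.

(* A Borel probability measure on K is a Borel probability measure on 'rV[R]_d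
   giving full mass to K.  The dual operator is given by
   <T^* mu, f> = <mu, T f> for every f in C(K). *)
Definition ruelle_pair (R : realType) (d : nat) (K : set 'rV[R]_d)
    (T : ('rV[R]_d -> R) -> ('rV[R]_d -> R))
    (h : 'rV[R]_d -> R) (mu : probability (borel_rV R d) R) : Prop :=
  let rho := spectral_radius K T in
  (CK K h /\ forall x, K x -> 0 < h x) /\
  mu K = 1%E /\
  {in K, forall x, T h x = rho * h x} /\
  (forall f, CK K f -> pairing K mu (T f) = rho * pairing K mu f) /\
  pairing K mu h = 1 /\
  (forall f, CK K f ->
     supnorm K (fun x => rho ^- n * iter n T f x - pairing K mu f * h x)
       @[n --> \oo] --> (0 : R)).

Definition ruelle_operator_theorem (R : realType) (d m : nat)
    (K : set 'rV[R]_d) (w : 'I_m -> 'rV[R]_d -> 'rV[R]_d)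
    (p : 'I_m -> 'rV[R]_d -> R) : Prop :=
  exists (h : 'rV[R]_d -> R) (mu : probability (borel_rV R d) R),
    ruelle_pair K (ruelle w p) h mu /\
    (forall h' (mu' : probability (borel_rV R d) R),
       ruelle_pair K (ruelle w p) h' mu' ->
       {in K, h' =1 h} /\ (forall A, measurable A -> mu' A = mu A)).

(* Main.v *)
From HB Require Import structures.
Require Import Defs.
From mathcomp Require Import all_boot all_order all_algebra.
From mathcomp Require Import all_classical all_reals all_analysis.
From mathcomp Require Import measurable_realfun complex ring lra.
Import Order.TTheory GRing.Theory Num.Theory.
Import numFieldTopology.Exports numFieldNormedType.Exports.
Local Open Scope classical_set_scope.
Local Open Scope ring_scope.

Set Implicit Arguments.
Unset Strict Implicit.
Unset Printing Implicit Defensive.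

(** Write u_n = T^n 1.  The hypothesis gives a/b < th < 1, where a and b are the
two sides of the inequality.  Since a point pair at distance d has, on average,
images at distance at most (a/b) d, an induction on n at the scales s th^i, on
which the moduli of the p_j are summable by the Dini condition, bounds the
distortion of u_n: sup u_n <= C inf u_n with C independent of n.  The same
induction makes the functions T^n f / u_n equicontinuous.  The weakly contractive
map w_j0 shrinks K into small sets, so positivity of the weights forces the
oscillation of T^n f / u_n to 0; its limit is a positive linear functional lam.
Then lam(T f) = rho lam(f), and u_n / rho^n converges uniformly to the
eigenfunction h.  The measure mu represents lam (Riesz), and the Neumann series
shows that rho is the spectral radius. *)

(** Only the average over the images contracts: a single [w j] may keep every distance, so following
    one pair through smaller and smaller scales does not bound the distortion. The estimates
    therefore carry a remainder that takes over whenever a pair is too far apart for its scale. The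
    remainder is linear in the distance, hence averaging it with the weights [p j x] multiplies it
    by at most [a]; passing to the next scale costs a factor [th^-1], while the mass grows by at
    least [b]. Relative to the mass it is thus multiplied by [q = a / (b * th)] at each step, and
    [q < 1] because [th] lies strictly between [a / b] and 1. Neither a fixed point theorem nor an
    extraction of subsequences occurs: convergence is proved uniformly over bounded equicontinuous
    families and, applied to the family of all [u k / rho ^+ k], it makes this very sequence
    uniformly Cauchy. The functional comes before the measure, so [rho] is at first only its value
    at [T 1]. *)

Section TransferOperator.
Variables (R : realType) (V : Type) (m : nat).
Variables (w : 'I_m -> V -> V) (p : 'I_m -> V -> R).

Definition transfer (f : V -> R) : V -> R :=
  fun x => \sum_(j < m) p j x * f (w j x).

Lemma transferS n f x :
  iter n.+1 transfer f x = \sum_(j < m) p j x * iter n transfer f (w j x).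
Proof. by []. Qed.

Lemma iter_transferD n f g x :
  iter n transfer (fun y => f y + g y) x =
  iter n transfer f x + iter n transfer g x.
Proof.
elim: n x => // n IH x; rewrite !transferS -big_split /=.
by apply: eq_bigr => j _; rewrite IH mulrDr.
Qed.

Lemma iter_transferZ n c f x :
  iter n transfer (fun y => c * f y) x = c * iter n transfer f x.
Proof.
elim: n x => // n IH x; rewrite !transferS mulr_sumr.
by apply: eq_bigr => j _; rewrite IH mulrCA.
Qed.

Lemma iter_transferB n f g x :
  iter n transfer (fun y => f y - g y) x =
  iter n transfer f x - iter n transfer g x.
Proof.
rewrite -mulN1r -iter_transferZ -iter_transferD.
by congr (iter n transfer _ x); apply/funext => y; rewrite mulN1r.
Qed.

Variable K : set V.
Hypothesis wK : forall j x, K x -> K (w j x).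
Hypothesis p_ge0 : forall j x, K x -> 0 <= p j x.

Lemma le_iter_transfer n f g : (forall x, K x -> f x <= g x) ->
  forall x, K x -> iter n transfer f x <= iter n transfer g x.
Proof.
move=> fg; elim: n => // n IH x Kx.
rewrite !transferS; apply: ler_sum => j _.
by apply: ler_wpM2l; [exact: p_ge0|exact/IH/wK].
Qed.

Lemma iter_transfer_norm n f x : K x ->
  `|iter n transfer f x| <= iter n transfer (fun y => `|f y|) x.
Proof.
elim: n x => // n IH x Kx; rewrite !transferS.
apply: le_trans (ler_norm_sum _ _ _) _; apply: ler_sum => j _.
rewrite normrM ger0_norm; last exact: p_ge0.
by apply: ler_wpM2l; [exact: p_ge0|exact/IH/wK].
Qed.

End TransferOperator.

(** * Distortion and convergence of the iterates *)

Section Distortion.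
Variables (R : realType) (V : Type) (m : nat).
Variables (w : 'I_m -> V -> V) (p : 'I_m -> V -> R).
Variables (K : set V) (dist : V -> V -> R) (L : 'I_m -> V -> R).
Variables (c0 B D a b th : R) (x1 : V).
Hypothesis dist_ge0 : forall x y, 0 <= dist x y.
Hypothesis dist_le : forall x y, K x -> K y -> dist x y <= D.
Hypothesis D_gt0 : 0 < D.
Hypothesis Kx1 : K x1.
Hypothesis wK : forall j x, K x -> K (w j x).
Hypothesis w_nonexp : forall j x y, K x -> K y ->
  dist (w j x) (w j y) <= dist x y.
Hypothesis w_lip : forall j x y, K x -> K y ->
  dist (w j x) (w j y) <= L j x * dist x y.
Hypothesis c0_gt0 : 0 < c0.
Hypothesis p_ge : forall j x, K x -> c0 <= p j x.
Hypothesis p_le : forall j x, K x -> p j x <= B.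
Hypothesis a_ge0 : 0 <= a.
Hypothesis th_gt0 : 0 < th.
Hypothesis th_lt1 : th < 1.
Hypothesis a_lt : a < b * th.
Hypothesis le_a : forall x, K x -> \sum_(j < m) p j x * L j x <= a.
Hypothesis b_le : forall x, K x -> b <= \sum_(j < m) p j x.
Hypothesis p_dini : forall s : R, 0 < s -> exists (e : nat -> R) (S : R),
  [/\ forall i, 0 <= e i, forall n, \sum_(i < n) e i <= S &
    forall i j x y, K x -> K y -> dist x y <= s * th ^+ i ->
      `|p j x - p j y| <= e i].

Local Notation T := (transfer w p).
Definition mass n : V -> R := iter n T (fun=> 1).
Local Notation u := mass.

Let p_ge0 j x : K x -> 0 <= p j x.
Proof. by move=> Kx; apply: le_trans (p_ge _ Kx); exact: ltW. Qed.

Let b_gt0 : 0 < b.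
Proof. by rewrite -(pmulr_lgt0 _ th_gt0); exact: le_lt_trans a_lt. Qed.

Let MB := m%:R * B.

Lemma massS n x : u n.+1 x = \sum_(j < m) p j x * u n (w j x).
Proof. by []. Qed.

Lemma sum_p_le x : K x -> \sum_(j < m) p j x <= MB.
Proof.
move=> Kx; rewrite /MB mulr_natl -[X in _ *+ X]card_ord -sumr_const.
by apply: ler_sum => j _; exact: p_le.
Qed.

Let MB_gt0 : 0 < MB.
Proof. by apply: lt_le_trans (sum_p_le Kx1); apply: lt_le_trans (b_le Kx1). Qed.

Lemma mass_ge n x : K x -> b ^+ n <= u n x.
Proof.
elim: n x => [|n IH] x Kx; first by rewrite expr0.
rewrite massS exprS; apply: (@le_trans _ _ (\sum_(j < m) p j x * b ^+ n)).
  by rewrite -mulr_suml ler_wpM2r// ?b_le// exprn_ge0// ltW.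
by apply: ler_sum => j _; apply: ler_wpM2l; [exact: p_ge0|exact/IH/wK].
Qed.

Lemma mass_gt0 n x : K x -> 0 < u n x.
Proof. by move=> Kx; apply: lt_le_trans (mass_ge n Kx); rewrite exprn_gt0. Qed.

Let u_ge0 n x : K x -> 0 <= u n x.
Proof. by move=> Kx; exact/ltW/mass_gt0. Qed.

Lemma mass_step_le n x c : K x -> (forall y, K y -> u n y <= c) ->
  u n.+1 x <= MB * c.
Proof.
move=> Kx uc; rewrite massS.
apply: (@le_trans _ _ (\sum_(j < m) p j x * c)).
  by apply: ler_sum => j _; apply: ler_wpM2l; [exact: p_ge0|exact/uc/wK].
rewrite -mulr_suml ler_wpM2r ?sum_p_le//.
by apply: le_trans (uc _ Kx1); exact: u_ge0.
Qed.

Lemma mass_le n x : K x -> u n x <= MB ^+ n.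
Proof.
elim: n x => [|n IH] x Kx; first by rewrite expr0.
by rewrite exprS; exact: mass_step_le.
Qed.

Definition mass_sup n : R := sup [set u n x | x in K].
Definition mass_inf n : R := inf [set u n x | x in K].
Local Notation A := mass_sup.
Local Notation A' := mass_inf.

Lemma mass_le_sup n x : K x -> u n x <= A n.
Proof.
move=> Kx; apply: ub_le_sup; last by exists x.
by exists (MB ^+ n) => _ [y Ky <-]; exact: mass_le.
Qed.

Lemma mass_sup_le n c : (forall x, K x -> u n x <= c) -> A n <= c.
Proof.
move=> uc; apply: ge_sup; first by exists (u n x1), x1.
by move=> _ [y Ky <-]; exact: uc.
Qed.

Lemma mass_inf_le n x : K x -> A' n <= u n x.
Proof.
move=> Kx; apply: ge_inf; last by exists x.
by exists (b ^+ n) => _ [y Ky <-]; exact: mass_ge.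
Qed.

Lemma le_mass_inf n c : (forall x, K x -> c <= u n x) -> c <= A' n.
Proof.
move=> uc; apply: lb_le_inf; first by exists (u n x1), x1.
by move=> _ [y Ky <-]; exact: uc.
Qed.

Lemma mass_sup_gt0 n : 0 < A n.
Proof. by apply: lt_le_trans (mass_le_sup n Kx1); exact: mass_gt0. Qed.

Lemma mass_inf_gt0 n : 0 < A' n.
Proof.
have : b ^+ n <= A' n by apply: le_mass_inf => x; exact: mass_ge.
by apply: lt_le_trans; rewrite exprn_gt0.
Qed.

Let A_ge0 n : 0 <= A n. Proof. exact/ltW/mass_sup_gt0. Qed.
Let A'_ge0 n : 0 <= A' n. Proof. exact/ltW/mass_inf_gt0. Qed.

(** With [massD_ge], this lets error terms that arise at different times all be measured against the
    mass at one and the same time. *)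
Lemma massD_ge_inf k n x : K x -> A' n * u k x <= u (k + n) x.
Proof.
move=> Kx; rewrite /mass -iter_transferZ iterD.
apply: (le_iter_transfer wK p_ge0) => // y Ky.
by rewrite /= mulr1; exact: mass_inf_le.
Qed.

Lemma massD_ge k n x : K x -> b ^+ k * A' n <= u (k + n) x.
Proof.
move=> Kx; apply: le_trans (massD_ge_inf k n Kx).
by rewrite mulrC ler_wpM2l// mass_ge.
Qed.

(** * Distortion estimate along geometric scales *)

Section Scale.
Variables (s : R) (e : nat -> R) (S : R).
Hypothesis s_gt0 : 0 < s.
Hypothesis e_ge0 : forall i, 0 <= e i.
Hypothesis e_sum : forall n, \sum_(i < n) e i <= S.
Hypothesis e_mod : forall i j x y, K x -> K y -> dist x y <= s * th ^+ i ->
  `|p j x - p j y| <= e i.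

Let sth_gt0 i : 0 < s * th ^+ i.
Proof. by rewrite mulr_gt0// exprn_gt0. Qed.

(** The distortion still to be spent from scale [i] on: it dominates every product of the later
    factors [1 + e k / c0]. *)
Let Q i := expR ((S - \sum_(k < i) e k) / c0).

Let Q_ge1 i : 1 <= Q i.
Proof. by rewrite -expR0 ler_expR divr_ge0 ?subr_ge0// ltW. Qed.

Let Q_step i : (1 + e i / c0) * Q i.+1 <= Q i.
Proof.
have -> : Q i = expR (e i / c0) * Q i.+1.
  have sumS : \sum_(k < i.+1) e k = \sum_(k < i) e k + e i.
    by rewrite big_ord_recr.
  by rewrite /Q sumS -expRD; congr expR; ring.
by rewrite ler_wpM2r ?expR_ge0// expR_ge1Dx.
Qed.

(** The lower bound [c0] of the weights turns the additive modulus into a multiplicative one. *)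
Lemma p_ratio i j x y : K x -> K y -> dist x y <= s * th ^+ i ->
  p j x <= (1 + e i / c0) * p j y.
Proof.
move=> Kx Ky xy; have := e_mod j Kx Ky xy; rewrite ler_norml => /andP[_].
rewrite lerBlDr => /le_trans; apply.
rewrite mulrDl mul1r addrC lerD2l -mulrA ler_peMr//.
by rewrite mulrC ler_pdivlMr// mul1r p_ge.
Qed.

(** Remainder of a pair cut off after [k] steps, at scale index [i + k]: [a ^+ k] is the averaged
    contraction so far, [A (n - k)] bounds the mass of the remaining steps. *)
Let term n i k d := A (n - k) * (a ^+ k * (d / (s * th ^+ (i + k)))).

Let term_ge0 n i k d : 0 <= d -> 0 <= term n i k d.
Proof.
move=> d0; rewrite mulr_ge0// mulr_ge0 ?exprn_ge0// divr_ge0//.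
exact/ltW/sth_gt0.
Qed.

(** The scale index grows at each step whether or not the images fit the new scale. If the pair is
    farther apart than its scale, the term of index 0 alone exceeds [A n]. Otherwise the factor
    [1 + e i / c0] is paid out of [Q i], and the remainders of the images, being linear in their
    distances, average to at most [a] times the same slope times the distance of the pair. *)
Lemma distortion_step n i x y : K x -> K y ->
  u n x <= Q i * u n y + \sum_(k < n.+1) term n i k (dist x y).
Proof.
elim: n i x y => [|n IH] i x y Kx Ky.
  rewrite big_ord1; apply: (@le_trans _ _ (Q i)); first exact: Q_ge1.
  by rewrite -[X in X <= _]addr0 mulr1 lerD2l term_ge0.
have [xy|xy] := leP (dist x y) (s * th ^+ i); last first.
  apply: (@le_trans _ _ (term n.+1 i 0 (dist x y))).
    rewrite /term subn0 expr0 mul1r addn0.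
    apply: le_trans (mass_le_sup _ Kx) _.
    by rewrite ler_peMr// ler_pdivlMr// mul1r ltW.
  rewrite big_ord_recl /= addrCA lerDl addr_ge0//.
    by apply: mulr_ge0; [exact: expR_ge0|exact: (u_ge0 n.+1)].
  by apply: sumr_ge0 => k _; exact: term_ge0.
pose tl x y := \sum_(k < n.+1) term n i.+1 k (dist x y).
have h1 : u n.+1 x <=
    \sum_(j < m) p j x * (Q i.+1 * u n (w j y)) +
    \sum_(j < m) p j x * tl (w j x) (w j y).
  rewrite massS -big_split /=; apply: ler_sum => j _.
  rewrite -mulrDr; apply: ler_wpM2l; first exact: p_ge0.
  by apply: IH; exact: wK.
apply: le_trans h1 _; apply: lerD.
  apply: (@le_trans _ _ (((1 + e i / c0) * Q i.+1) * u n.+1 y)).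
    rewrite massS mulr_sumr; apply: ler_sum => j _.
    rewrite [leRHS](_ : _ =
      (1 + e i / c0) * p j y * (Q i.+1 * u n (w j y))); last by ring.
    apply: ler_wpM2r; first by rewrite mulr_ge0 ?expR_ge0//; exact/u_ge0/wK.
    exact: p_ratio.
  by rewrite ler_wpM2r// u_ge0.
rewrite big_ord_recl /= -[X in X <= _]add0r; apply: lerD; first exact: term_ge0.
pose C := \sum_(k < n.+1) A (n - k) * (a ^+ k / (s * th ^+ (i.+1 + k))).
have C_ge0 : 0 <= C.
  apply: sumr_ge0 => k _; rewrite mulr_ge0// divr_ge0 ?exprn_ge0//.
  exact/ltW/sth_gt0.
have tlE x' y' : tl x' y' = dist x' y' * C.
  rewrite /tl /C mulr_sumr; apply: eq_bigr => k _; rewrite /term; ring.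
apply: (@le_trans _ _ (a * dist x y * C)).
  under eq_bigr do rewrite tlE.
  apply: (@le_trans _ _ (\sum_(j < m) p j x * L j x * (dist x y * C))).
    apply: ler_sum => j _; rewrite -mulrA; apply: ler_wpM2l; first exact: p_ge0.
    by rewrite mulrA ler_wpM2r// w_lip.
  by rewrite -mulr_suml -mulrA ler_wpM2r ?le_a// mulr_ge0.
rewrite /C mulr_sumr; apply: ler_sum => k _; rewrite /term.
rewrite /bump /= add1n subSS addSnnS exprS le_eqVlt; apply/orP; left; apply/eqP.
ring.
Qed.

End Scale.

Let q := a / (b * th).

Let q_ge0 : 0 <= q.
Proof. by rewrite divr_ge0// mulr_ge0// ltW. Qed.

Let q_lt1 : q < 1.
Proof. by rewrite ltr_pdivrMr ?mul1r// mulr_gt0. Qed.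

Let q1_gt0 : 0 < 1 - q. Proof. by rewrite subr_gt0. Qed.

Lemma geometric_sum_le (r : R) n : 0 <= r -> r < 1 ->
  \sum_(k < n) r ^+ k <= (1 - r)^-1.
Proof.
move=> r0 r1; rewrite -[leRHS]mul1r ler_pdivlMr ?subr_gt0//.
suff -> : (\sum_(k < n) r ^+ k) * (1 - r) = 1 - r ^+ n.
  by rewrite gerBl exprn_ge0.
elim: n => [|n IH]; first by rewrite big_ord0 mul0r expr0 subrr.
by rewrite big_ord_recr /= mulrDl IH exprS; ring.
Qed.

(** Isolates [b ^+ k], which [massD_ge] absorbs into the mass at the final time; the summable factor
    [q ^+ k] remains. *)
Lemma geometric_scale k d s i :
  a ^+ k * (d / (s * th ^+ (i + k))) = b ^+ k * q ^+ k * (d / (s * th ^+ i)).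
Proof.
rewrite /q exprMn exprVn exprMn exprD.
have bk : b ^+ k != 0 by rewrite expf_neq0// gt_eqF.
have tk : th ^+ k != 0 by rewrite expf_neq0// gt_eqF.
rewrite !invfM.
rewrite [RHS](_ : _ = (b ^+ k * (b ^+ k)^-1) *
  (a ^+ k * ((th ^+ k)^-1 * (d * (s^-1 * (th ^+ i)^-1))))); last by ring.
by rewrite divff// mul1r; ring.
Qed.

(* The scale is so large that the term of index 0 of the estimate can be
   absorbed in the left-hand side. *)
Lemma mass_distortion : exists2 C, 0 < C & forall n, A n <= C * A' n.
Proof.
pose s := 4 * D / (1 - q).
have s_gt0 : 0 < s by rewrite divr_gt0// mulr_gt0.
have [e [S [e_ge0 e_sum e_mod]]] := p_dini s_gt0.
pose Q0 := expR (S / c0).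
have Q0_gt0 : 0 < Q0 by exact: expR_gt0.
(* By the choice of [s], [D / s = (1 - q) / 4], and the factor [1 - q] cancels the sum of the
   geometric series. With [C / 4 = Q0] the bound becomes [A n <= 2 * Q0 * u n y + A n / 4], so [A n]
   is at most [(8 / 3) * Q0 * u n y], below [C * u n y]. *)
have [C CE] : exists C, C = 4 * Q0 by exists (4 * Q0).
have C_gt0 : 0 < C by rewrite CE mulr_gt0.
exists C => //.
move=> n; elim/ltn_ind: n => n IH.
rewrite -ler_pdivrMl//; apply: le_mass_inf => y Ky; rewrite ler_pdivrMl//.
suff : A n <= Q0 * u n y + (A n / 4 + C / 4 * u n y).
  by have := u_ge0 n Ky; rewrite CE; have := mass_sup_gt0 n; nra.
apply: mass_sup_le => x Kx.
apply: le_trans (distortion_step s_gt0 e_ge0 e_sum e_mod n 0 Kx Ky) _.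
rewrite big_ord0 subr0; apply: lerD => //.
have Ds : D / s = (1 - q) / 4.
  by rewrite /s; field; rewrite !gt_eqF//.
have d_le : dist x y / s <= (1 - q) / 4.
  by rewrite -Ds ler_pM2r ?invr_gt0// dist_le.
have d_ge : 0 <= dist x y / s by rewrite divr_ge0// ltW.
rewrite big_ord_recl /=; apply: lerD.
  rewrite subn0 expr0 mul1r addn0 expr0 mulr1; apply: ler_wpM2l => //.
  by apply: le_trans d_le _; have := q_ge0; lra.
apply: (@le_trans _ _ (\sum_(k < n) C * u n y * ((1 - q) / 4) * q ^+ k)).
  apply: ler_sum => k _; rewrite geometric_scale expr0 mulr1 /bump /= !add1n.
  have An : A (n - k.+1) * b ^+ k.+1 <= C * u n y.
    apply: (@le_trans _ _ (C * (b ^+ k.+1 * A' (n - k.+1)))).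
      rewrite mulrCA mulrC ler_wpM2l ?exprn_ge0//; first exact: ltW.
      by apply: IH; rewrite ltn_subrL /=; exact: leq_ltn_trans (ltn_ord k).
    rewrite ler_pM2l//; have := massD_ge k.+1 (n - k.+1) Ky.
    by rewrite subnKC.
  rewrite [leLHS](_ : _ =
    A (n - k.+1) * b ^+ k.+1 * (q ^+ k.+1 * (dist x y / s))); last first.
    by rewrite !mulrA.
  rewrite -[leRHS]mulrA.
  rewrite [leRHS](_ : _ = C * u n y * (q ^+ k * ((1 - q) / 4))); last first.
    by rewrite [q ^+ k * _]mulrC.
  apply: ler_pM => //; first by rewrite mulr_ge0 ?exprn_ge0// ltW.
    by rewrite mulr_ge0 ?exprn_ge0.
  apply: ler_pM => //; first by rewrite exprn_ge0.
  by rewrite exprS ler_piMl ?exprn_ge0// ltW.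
rewrite -mulr_sumr; have gs := geometric_sum_le n q_ge0 q_lt1.
apply: (@le_trans _ _ (C * u n y * ((1 - q) / 4) * (1 - q)^-1)).
  by apply: ler_wpM2l => //; rewrite !mulr_ge0 ?u_ge0// ltW.
rewrite le_eqVlt; apply/orP; left; apply/eqP; field.
by rewrite gt_eqF.
Qed.

(** A partial sum within [eps] of the supremum of all partial sums leaves at most [eps] for any
    later block. *)
Lemma tail_sum_small (e : nat -> R) S : (forall i, 0 <= e i) ->
  (forall n, \sum_(i < n) e i <= S) ->
  forall eps, 0 < eps -> exists i, forall n, \sum_(k < n) e (i + k)%N <= eps.
Proof.
move=> e_ge0 e_sum eps eps_gt0.
pose P := [set \sum_(i < n) e i | n in [set: nat]].
have P_sup : has_sup P.
  split; first by exists (\sum_(i < 0) e i), 0%N.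
  by exists S => _ [n _ <-].
have [_ [i _ <-] Si] := sup_adherent eps_gt0 P_sup.
exists i => n; have : \sum_(k < i + n) e k <= sup P.
  by apply: ub_le_sup; [case: P_sup|exists (i + n)%N].
rewrite big_split_ord /= => h.
by rewrite -(lerD2l (\sum_(k < i) e k)); apply: le_trans h _; lra.
Qed.

(** * Equicontinuity of the iterates relative to the mass *)

Definition UC (f : V -> R) := forall eps, 0 < eps -> exists2 del, 0 < del &
  forall x y, K x -> K y -> dist x y <= del -> `|f x - f y| <= eps.

Definition equi (F : set (V -> R)) := forall eps, 0 < eps ->
  exists2 del, 0 < del &
  forall f x y, F f -> K x -> K y -> dist x y <= del -> `|f x - f y| <= eps.

Definition bounded_by M (F : set (V -> R)) :=
  forall f x, F f -> K x -> `|f x| <= M.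

Lemma mass_step_ge n x : K x -> b * u n x <= u n.+1 x.
Proof.
move=> Kx; rewrite /mass iterSr -iter_transferZ.
apply: (le_iter_transfer wK p_ge0) => // y Ky.
rewrite /transfer mulr1; under eq_bigr do rewrite mulr1; exact: b_le.
Qed.

Lemma iter_transfer_bound M f n x : 0 <= M ->
  (forall y, K y -> `|f y| <= M) -> K x ->
  `|iter n T f x| <= M * u n x.
Proof.
move=> M0 fM Kx; apply: le_trans (iter_transfer_norm wK p_ge0 _ _ Kx) _.
rewrite /mass -iter_transferZ; apply: (le_iter_transfer wK p_ge0) => // y Ky.
by rewrite /= mulr1; exact: fM.
Qed.

Section Scale.
Variables (s : R) (e : nat -> R) (S : R).
Hypothesis s_gt0 : 0 < s.
Hypothesis e_ge0 : forall i, 0 <= e i.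
Hypothesis e_sum : forall n, \sum_(i < n) e i <= S.
Hypothesis e_mod : forall i j x y, K x -> K y -> dist x y <= s * th ^+ i ->
  `|p j x - p j y| <= e i.

Let sth_gt0 i : 0 < s * th ^+ i.
Proof. by rewrite mulr_gt0// exprn_gt0. Qed.

(** Merges near and far pairs: beyond the scale the second summand alone exceeds [B], so the
    induction below has no case distinction. *)
Let p_dist i j x y : K x -> K y ->
  `|p j x - p j y| <= e i + B * (dist x y / (s * th ^+ i)).
Proof.
move=> Kx Ky; have B_ge0 : 0 <= B by exact: le_trans (p_ge0 j Kx) (p_le j Kx).
have [xy|xy] := leP (dist x y) (s * th ^+ i).
  apply: le_trans (e_mod j Kx Ky xy) _.
  by rewrite lerDl mulr_ge0// divr_ge0// ltW.
apply: (@le_trans _ _ (B * (dist x y / (s * th ^+ i)))).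
  apply: (@le_trans _ _ B).
    rewrite ler_norml; have := p_ge0 j Kx; have := p_ge0 j Ky.
    by have := p_le j Kx; have := p_le j Ky; lra.
  by rewrite ler_peMr// ler_pdivlMr// mul1r ltW.
by rewrite lerDr.
Qed.

(** The summand of index [k] pays for exchanging the weights after [k] steps, when [n - k.+1] steps
    remain. *)
Let err n i x y := \sum_(k < n) A (n - k.+1) *
  (u k x * (m%:R * e (i + k)%N) +
   MB * (a ^+ k * (dist x y / (s * th ^+ (i + k))))).

(** The weights at [x] are exchanged for those at [y] one step at a time. Nonexpansiveness keeps all
    images of the pair within [del], so [f] itself contributes only [eps] times the mass. *)
Lemma iter_transfer_dist M del eps f : 0 <= M -> 0 <= eps ->
  (forall x, K x -> `|f x| <= M) ->
  (forall x y, K x -> K y -> dist x y <= del -> `|f x - f y| <= eps) ->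
  forall n i x y, K x -> K y -> dist x y <= del ->
  `|iter n T f x - iter n T f y| <= u n x * eps + M * err n i x y.
Proof.
move=> M0 eps0 fM f_eps; elim=> [|n IH] i x y Kx Ky xy.
  by rewrite /err big_ord0 mulr0 addr0 mul1r; exact: f_eps.
have -> : iter n.+1 T f x - iter n.+1 T f y =
    \sum_(j < m) p j x * (iter n T f (w j x) - iter n T f (w j y)) +
    \sum_(j < m) (p j x - p j y) * iter n T f (w j y).
  rewrite !transferS -sumrB -big_split /=; apply: eq_bigr => j _; ring.
apply: le_trans (ler_normD _ _) _.
have h2 : `|\sum_(j < m) (p j x - p j y) * iter n T f (w j y)| <=
    M * (A n * (m%:R * e i + MB * (dist x y / (s * th ^+ i)))).
  apply: le_trans (ler_norm_sum _ _ _) _.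
  apply: (@le_trans _ _ (\sum_(j < m)
      (e i + B * (dist x y / (s * th ^+ i))) * (M * A n))).
    apply: ler_sum => j _; rewrite normrM; apply: ler_pM => //.
      exact: p_dist.
    apply: (@le_trans _ _ (M * u n (w j y))).
      by apply: iter_transfer_bound => //; exact: wK.
    by apply: ler_wpM2l => //; apply/mass_le_sup/wK.
  rewrite sumr_const card_ord -mulr_natl /MB le_eqVlt; apply/orP; left.
  by apply/eqP; ring.
have h1 : `|\sum_(j < m) p j x * (iter n T f (w j x) - iter n T f (w j y))| <=
    \sum_(j < m) p j x * (u n (w j x) * eps + M * err n i.+1 (w j x) (w j y)).
  apply: le_trans (ler_norm_sum _ _ _) _; apply: ler_sum => j _.
  rewrite normrM ger0_norm ?p_ge0//; apply: ler_wpM2l; first exact: p_ge0.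
  apply: IH; [exact: wK|exact: wK|].
  by apply: le_trans xy; exact: w_nonexp.
apply: le_trans (lerD h1 h2) _.
have -> : \sum_(j < m) p j x * (u n (w j x) * eps + M * err n i.+1 (w j x) (w j y)) =
   u n.+1 x * eps + M * \sum_(j < m) p j x * err n i.+1 (w j x) (w j y).
  rewrite massS mulr_suml mulr_sumr -big_split /=; apply: eq_bigr => j _; ring.
rewrite -addrA lerD2l -mulrDr; apply: ler_wpM2l => //.
rewrite /err big_ord_recl subn1 expr0 mul1r addn0 /= mul1r addrC lerD2l.
rewrite /bump /=; under eq_bigr do rewrite mulr_sumr.
rewrite exchange_big /=; apply: ler_sum => k _.
rewrite add1n subSS; under eq_bigr do rewrite mulrCA.
rewrite -mulr_sumr; apply: ler_wpM2l => //.
rewrite -addSnnS.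
under eq_bigr do rewrite mulrDr; rewrite big_split /=; apply: lerD.
  rewrite -[T _ x]/(u k.+1 x) massS mulr_suml.
  by apply: ler_sum => j _; rewrite -[leRHS]mulrA.
pose c := MB * (a ^+ k / (s * th ^+ (i.+1 + k))).
have c_ge0 : 0 <= c.
  by rewrite mulr_ge0 ?(ltW MB_gt0)// divr_ge0 ?exprn_ge0// ltW.
apply: (@le_trans _ _ (\sum_(j < m) p j x * L j x * (dist x y * c))).
  apply: ler_sum => j _.
  rewrite [leLHS](_ : _ = p j x * (dist (w j x) (w j y) * c)); last first.
    by rewrite /c; ring.
  rewrite -mulrA; apply: ler_wpM2l; first exact: p_ge0.
  by rewrite mulrA; apply: ler_wpM2r => //; exact: w_lip.
rewrite -mulr_suml; apply: (@le_trans _ _ (a * (dist x y * c))).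
  by apply: ler_wpM2r; [exact: mulr_ge0|exact: le_a].
by rewrite /c exprS le_eqVlt; apply/orP; left; apply/eqP; ring.
Qed.

(** Bounded distortion replaces [A] by [A'], and both [A' (n - k.+1) * u k x] and
    [b ^+ k * A' (n - k.+1)] are at most the mass after [n - 1] steps; the missing step costs the
    factor [b^-1]. *)
Lemma err_le C i n x y : 0 <= C -> (forall k, A k <= C * A' k) ->
  K x -> K y ->
  err n i x y <= C / b * u n x *
    (m%:R * \sum_(k < n) e (i + k)%N +
     MB * (dist x y / (s * th ^+ i)) / (1 - q)).
Proof.
move=> C0 AC Kx Ky; pose d := MB * (dist x y / (s * th ^+ i)).
have d_ge0 : 0 <= d.
  by rewrite mulr_ge0 ?(ltW MB_gt0)// divr_ge0// ltW.
apply: (@le_trans _ _ (C / b * u n x *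
    \sum_(k < n) (m%:R * e (i + k)%N + d * q ^+ k))); last first.
  apply: ler_wpM2l; first by rewrite mulr_ge0 ?u_ge0// divr_ge0// ltW.
  rewrite big_split /= -!mulr_sumr lerD2l.
  by apply: ler_wpM2l => //; exact: geometric_sum_le q_ge0 q_lt1.
rewrite /err mulr_sumr; apply: ler_sum => k _.
case: n k => [[]//|n] k; rewrite subSS mulrDr mulrDr.
have kn : (k + (n - k) = n)%N by rewrite subnKC// -ltnS.
have Cu : C * u n x <= C / b * u n.+1 x.
  rewrite -mulrA; apply: ler_wpM2l => //.
  by rewrite ler_pdivlMl//; exact: mass_step_ge.
apply: lerD.
  rewrite mulrA; apply: ler_wpM2r; first by rewrite mulr_ge0.
  apply: le_trans Cu; apply: (@le_trans _ _ (C * (A' (n - k) * u k x))).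
    by rewrite mulrA; apply: ler_wpM2r; [exact: u_ge0|exact: AC].
  by apply: ler_wpM2l => //; have := massD_ge_inf k (n - k) Kx; rewrite kn.
rewrite geometric_scale [leLHS](_ : _ = (A (n - k) * b ^+ k) * (d * q ^+ k));
  last by rewrite /d; ring.
apply: ler_wpM2r; first by rewrite mulr_ge0 ?exprn_ge0.
apply: le_trans Cu; apply: (@le_trans _ _ (C * (b ^+ k * A' (n - k)))).
  by rewrite mulrCA mulrC; apply: ler_wpM2l; [rewrite exprn_ge0// ltW|].
by apply: ler_wpM2l => //; have := massD_ge k (n - k) Kx; rewrite kn.
Qed.

End Scale.

(** The order of choices matters: first [i], making the tail of the moduli small, then [del],
    depending on [i], making the linear part small. Neither depends on [n], since all errors are
    relative to [u n x]. *)
Lemma iter_transfer_equi M F : 0 <= M -> bounded_by M F -> equi F ->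
  forall eps, 0 < eps -> exists2 del, 0 < del & forall f n x y, F f ->
    K x -> K y -> dist x y <= del ->
    `|iter n T f x - iter n T f y| <= eps * u n x.
Proof.
move=> M0 FM Fequi eps eps_gt0.
have [C C_gt0 AC] := mass_distortion.
have [e [S [e_ge0 e_sum e_mod]]] := p_dini (@ltr01 R).
have e2 : 0 < eps / 2 by rewrite divr_gt0.
have [d1 d1_gt0 Fd1] := Fequi _ e2.
have MC_gt0 : 0 < (M + 1) * (C / b).
  by apply: mulr_gt0; [lra|exact: divr_gt0].
(* The two parts of the error are made at most [eta] each, which gives [eps / 2] after
   multiplication by [M * (C / b)]. Writing [M + 1], and later [m%:R + 1], keeps the divisors
   positive. *)
pose eta := eps / 4 / ((M + 1) * (C / b)).
have eta_gt0 : 0 < eta by rewrite !divr_gt0.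
have m1_gt0 : 0 < (m%:R + 1 : R) by rewrite ltr_wpDl.
have [i e_tail] := tail_sum_small e_ge0 e_sum (divr_gt0 eta_gt0 m1_gt0).
pose d2 := eta * (1 - q) / MB * (1 * th ^+ i).
have d2_gt0 : 0 < d2 by rewrite !mulr_gt0 ?invr_gt0 ?exprn_gt0.
exists (Num.min d1 d2); first by rewrite lt_min d1_gt0.
move=> f n x y Ff Kx Ky; rewrite le_min => /andP[xy1 xy2].
have h := iter_transfer_dist (@ltr01 R) e_ge0 e_mod M0 (ltW e2)
  (fun x => FM f x Ff) (fun x y => Fd1 f x y Ff) n i Kx Ky xy1.
apply: le_trans h _.
suff h : M * (\sum_(k < n) A (n - k.+1) *
    (u k x * (m%:R * e (i + k)%N) +
     MB * (a ^+ k * (dist x y / (1 * th ^+ (i + k)))))) <= eps / 2 * u n x.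
  by move: h; lra.
have h := err_le (@ltr01 R) e_ge0 i n (ltW C_gt0) AC Kx Ky.
apply: le_trans (ler_wpM2l M0 h) _.
have t1 : m%:R * \sum_(k < n) e (i + k)%N <= eta.
  apply: (@le_trans _ _ (m%:R * (eta / (m%:R + 1)))).
    by apply: ler_wpM2l => //; exact: e_tail.
  rewrite mulrCA ler_piMr ?ltW// ltr_pdivrMr//; lra.
have t2 : MB * (dist x y / (1 * th ^+ i)) / (1 - q) <= eta.
  rewrite ler_pdivrMr// mulrC -ler_pdivlMr// ler_pdivrMr//.
  by rewrite mul1r exprn_gt0.
apply: (@le_trans _ _ ((M + 1) * (C / b * u n x * (eta + eta)))).
  have Cu : 0 <= C / b * u n x by rewrite mulr_ge0 ?u_ge0// divr_ge0// ltW.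
  apply: ler_pM => //; last 2 first.
  - by lra.
  - by apply: ler_wpM2l => //; exact: lerD.
  apply: mulr_ge0 => //; apply: addr_ge0.
    by rewrite mulr_ge0// sumr_ge0.
  rewrite divr_ge0 ?(ltW q1_gt0)// mulr_ge0 ?(ltW MB_gt0)// divr_ge0//.
  by rewrite mul1r exprn_ge0// ltW.
rewrite le_eqVlt; apply/orP; left; apply/eqP.
rewrite [LHS](_ : _ = (M + 1) * (C / b) * eta * (2 * u n x)); last by ring.
have -> : (M + 1) * (C / b) * eta = eps / 4 by rewrite mulrC divfK// gt_eqF.
by field.
Qed.

(** * Decay of the oscillation of the normalized iterates *)

Variable j0 : 'I_m.
Hypothesis w_contr : forall del, 0 < del -> exists N, forall x y, K x -> K y ->
  dist (iter N (w j0) x) (iter N (w j0) y) <= del.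

Lemma iter_wK n x : K x -> K (iter n (w j0) x).
Proof. by move=> Kx; elim: n => //= n; exact: wK. Qed.

(** Keeps only the branch that applies [w j0] at every step; the other branches are nonnegative. *)
Lemma iter_transfer_ge n g x : (forall y, K y -> 0 <= g y) -> K x ->
  c0 ^+ n * g (iter n (w j0) x) <= iter n T g x.
Proof.
move=> g0; elim: n x => [|n IH] x Kx; first by rewrite mul1r.
have Tg_ge0 j : 0 <= iter n T g (w j x).
  apply: le_trans (IH _ (wK j Kx)).
  by rewrite mulr_ge0 ?exprn_ge0 ?(ltW c0_gt0)//; exact/g0/iter_wK/wK.
rewrite transferS (bigD1 j0)//= -[leLHS]addr0; apply: lerD; last first.
  by apply: sumr_ge0 => j _; rewrite mulr_ge0// p_ge0.
rewrite -iterS iterSr exprS -mulrA.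
apply: ler_pM; [exact: ltW| |exact: p_ge|exact/IH/wK].
by rewrite mulr_ge0 ?exprn_ge0 ?(ltW c0_gt0)//; exact/g0/iter_wK/wK.
Qed.

(** Bounds on the ratio of [T^n f] to [u n], written without division so that positivity of [T]
    propagates them to later times. *)
Definition between lo hi n (f : V -> R) := forall x, K x ->
  lo * u n x <= iter n T f x <= hi * u n x.

Lemma betweenD lo hi n k f : between lo hi n f -> between lo hi (k + n) f.
Proof.
move=> bf x Kx; rewrite /mass -!iter_transferZ !iterD.
apply/andP; split; apply: (le_iter_transfer wK p_ge0) => // y Ky;
  by rewrite iter_transferZ; have /andP[] := bf y Ky.
Qed.

(* A nonnegative function that is large on the small set w_j0^N(K) becomes
   large everywhere after N steps. *)
Lemma gain C N n g kap : 0 <= kap -> 0 < C -> A n <= C * A' n ->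
  (forall y, K y -> 0 <= g y) ->
  (forall x, K x ->
     kap * u n (iter N (w j0) x) <= g (iter N (w j0) x)) ->
  forall x, K x ->
    c0 ^+ N * kap / (MB ^+ N * C) * u (N + n) x <= iter N T g x.
Proof.
move=> k0 C_gt0 AC g0 g_ge x Kx.
apply: le_trans (iter_transfer_ge _ g0 Kx).
have c0N : 0 <= c0 ^+ N by rewrite exprn_ge0// ltW.
have MBN : 0 < MB ^+ N by rewrite exprn_gt0.
rewrite -!mulrA; apply: ler_wpM2l => //.
apply: le_trans (g_ge _ Kx); apply: ler_wpM2l => //.
rewrite ler_pdivrMl ?mulr_gt0//.
(* Origin of the constant: [u (N + n) x] is at most [MB ^+ N * A n], and bounded distortion compares
   [A n] with the mass at the image of [x] under [N] steps of [w j0]. *)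
apply: (@le_trans _ _ (MB ^+ N * A n)).
  rewrite {1}/mass iterD -/(mass n).
  have -> : MB ^+ N * A n = A n * MB ^+ N by rewrite mulrC.
  apply: (@le_trans _ _ (A n * u N x)); last first.
    by apply: ler_wpM2l => //; exact: mass_le.
  rewrite [in leRHS]/mass -iter_transferZ.
  by apply: (le_iter_transfer wK p_ge0) => // y Ky; rewrite /= mulr1 mass_le_sup.
rewrite -mulrA; apply: ler_wpM2l; first exact: ltW.
apply: le_trans AC _; apply: ler_wpM2l; first exact: ltW.
exact/mass_inf_le/iter_wK.
Qed.

(** Equicontinuity relative to the mass is used twice, for the family in the numerator and for the
    constant 1 in the denominator. *)
Lemma ratio_equi M F : 0 <= M -> bounded_by M F -> equi F ->
  forall eps, 0 < eps -> exists2 del, 0 < del & forall f n x y, F f ->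
    K x -> K y -> dist x y <= del ->
    `|iter n T f x / u n x - iter n T f y / u n y| <= eps.
Proof.
move=> M0 FM Fequi eps eps_gt0.
have e1 : 0 < eps / 2 by rewrite divr_gt0.
have M1 : 0 < M + 1 by lra.
have e2 : 0 < eps / 2 / (M + 1) by rewrite divr_gt0.
have [d1 d1_gt0 h1] := iter_transfer_equi M0 FM Fequi e1.
pose G : set (V -> R) := [set fun=> 1].
have GM : bounded_by 1 G by move=> _ x -> _; rewrite normr1.
have Gequi : equi G.
  by move=> ep ep0; exists 1 => // _ x y -> _ _ _; rewrite subrr normr0 ltW.
have [d2 d2_gt0 h2] := iter_transfer_equi ler01 GM Gequi e2.
exists (Num.min d1 d2); first by rewrite lt_min d1_gt0.
move=> f n x y Ff Kx Ky; rewrite le_min => /andP[xy1 xy2].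
have ux := mass_gt0 n Kx; have uy := mass_gt0 n Ky.
have -> : iter n T f x / u n x - iter n T f y / u n y =
    ((iter n T f x - iter n T f y) +
     iter n T f y / u n y * (u n y - u n x)) / u n x.
  by field; rewrite !gt_eqF.
rewrite normrM normfV [`|u n x|]gtr0_norm// ler_pdivrMr//.
apply: le_trans (ler_normD _ _) _.
have -> : eps * u n x = eps / 2 * u n x + M * (eps / 2 / (M + 1) * u n x) +
   eps / 2 / (M + 1) * u n x by field; rewrite gt_eqF.
rewrite -addrA; apply: lerD; first exact: h1.
apply: (@le_trans _ _ (M * (eps / 2 / (M + 1) * u n x))); last first.
  by rewrite lerDl mulr_ge0 ?ltW.
rewrite normrM; apply: ler_pM => //; last first.
  by rewrite distrC; exact: (h2 (fun=> 1)).
rewrite normrM normfV [`|u n y|]gtr0_norm// ler_pdivrMr//.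
by apply: iter_transfer_bound => // z Kz; exact: FM.
Qed.

(** On the image of [K] under [N] steps of [w j0] the ratio varies by at most [eta / 4] from its
    value at [z]. That value is at least [eta / 2] away from [hi] or from [lo], so a gap [eta / 4]
    is left on the whole image, and [gain] spreads it over [K]. The constant [c] is the same for all
    [f] and [n]. *)
Lemma osc_step M F eta : 0 <= M -> bounded_by M F -> equi F -> 0 < eta ->
  exists N, exists2 c, 0 < c & forall f n lo hi, F f -> between lo hi n f ->
    eta <= hi - lo -> exists lo' hi',
    hi' - lo' <= hi - lo - c /\ between lo' hi' (N + n) f.
Proof.
move=> M0 FM Fequi eta_gt0.
have e4 : 0 < eta / 4 by rewrite divr_gt0.
have [del del_gt0 F_del] := ratio_equi M0 FM Fequi e4.
have [C C_gt0 AC] := mass_distortion.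
have [N N_del] := w_contr del_gt0.
pose c := c0 ^+ N * (eta / 4) / (MB ^+ N * C).
exists N, c.
  by rewrite /c divr_gt0// mulr_gt0// exprn_gt0.
move=> f n lo hi Ff bf lohi.
pose z := iter N (w j0) x1; have Kz : K z by exact: iter_wK.
have near_z x : K x -> `|iter n T f z / u n z -
    iter n T f (iter N (w j0) x) / u n (iter N (w j0) x)| <= eta / 4.
  by move=> Kx; apply: F_del => //; [exact: iter_wK|exact: N_del].
have bND := betweenD N bf.
have [rz|rz] := leP (iter n T f z / u n z) ((hi + lo) / 2).
  exists lo, (hi - c); split; first by lra.
  move=> x Kx; have /andP[-> _] /= := bND x Kx.
  have : c * u (N + n) x <= iter N T (fun y => hi * u n y - iter n T f y) x.
    apply: (gain (ltW e4) C_gt0 (AC n)) => // y Ky.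
      by rewrite subr_ge0; have /andP[] := bf y Ky.
    have uy := mass_gt0 n (iter_wK N Ky).
    rewrite lerBrDr -lerBrDl -mulrBl -ler_pdivrMr//.
    by have := near_z y Ky; rewrite ler_norml => /andP[]; lra.
  have -> : iter N T (fun y => hi * u n y - iter n T f y) x =
      hi * u (N + n) x - iter (N + n) T f x.
    by rewrite iter_transferB iter_transferZ /mass !iterD.
  by rewrite mulrBl; lra.
exists (lo + c), hi; split; first by lra.
move=> x Kx; have /andP[_ ->] := bND x Kx; rewrite andbT.
have : c * u (N + n) x <= iter N T (fun y => iter n T f y - lo * u n y) x.
  apply: (gain (ltW e4) C_gt0 (AC n)) => // y Ky.
    by rewrite subr_ge0; have /andP[] := bf y Ky.
  have uy := mass_gt0 n (iter_wK N Ky).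
  rewrite lerBrDr -mulrDl -ler_pdivlMr//.
  by have := near_z y Ky; rewrite ler_norml => /andP[]; lra.
have -> : iter N T (fun y => iter n T f y - lo * u n y) x =
    iter (N + n) T f x - lo * u (N + n) x.
  by rewrite iter_transferB iter_transferZ /mass !iterD.
by rewrite mulrDl; lra.
Qed.

Lemma osc_decay M F eta : 0 <= M -> bounded_by M F -> equi F -> 0 < eta ->
  exists N, forall f, F f -> exists lo hi,
    hi - lo <= eta /\ forall n, (N <= n)%N -> between lo hi n f.
Proof.
move=> M0 FM Fequi eta_gt0.
have [N [c c_gt0 step]] := osc_step M0 FM Fequi eta_gt0.
(* The initial width is [2 * M], and each round of [N] steps removes at least [c] until the width is
   at most [eta]. *)
pose k := Num.bound (2 * M / c).
exists (k * N)%N => f Ff.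
have [lo [hi [lohi bf]]] : exists lo hi,
    hi - lo <= Num.max eta (2 * M - k%:R * c) /\ between lo hi (k * N) f.
  elim: k => [|k [lo [hi [lohi bf]]]].
    exists (- M), M; split; first by rewrite le_max; apply/orP; right; lra.
    by move=> x Kx; rewrite !mulr1 -ler_norml; exact: FM.
  have [small|big] := leP (hi - lo) eta.
    exists lo, hi; split; first by rewrite le_max small.
    by rewrite mulSn; exact: betweenD.
  have [lo' [hi' [lohi' bf']]] := step f _ lo hi Ff bf (ltW big).
  exists lo', hi'; split; last by rewrite mulSn.
  move: lohi; rewrite !le_max leNgt big /= => lohi.
  by apply/orP; right; rewrite -natr1; lra.
exists lo, hi; split.
  apply: le_trans lohi _; rewrite ge_max lexx /=.
  suff : 2 * M <= k%:R * c by lra.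
  rewrite -ler_pdivrMr// ltW//; apply: archi_boundP.
  by rewrite divr_ge0 ?(ltW c_gt0)// mulr_ge0.
by move=> n /subnK <-; exact: betweenD.
Qed.

(** Stands for continuity on a compact set while [V] carries no topology and [dist] need not be a
    metric; [CK_BUC] identifies it with [CK] later. *)
Definition BUC f := (exists M, forall x, K x -> `|f x| <= M) /\ UC f.

Lemma BUC_bound f : BUC f -> exists2 M, 0 <= M & forall x, K x -> `|f x| <= M.
Proof.
move=> [[M fM] _]; exists M => //.
by apply: le_trans (fM _ Kx1); exact: normr_ge0.
Qed.

Lemma BUC_cst c : BUC (fun=> c).
Proof.
split; first by exists `|c|.
by move=> e e0; exists 1 => // x y _ _ _; rewrite subrr normr0 ltW.
Qed.

Lemma eq_BUC f g : (forall x, K x -> f x = g x) -> BUC f -> BUC g.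
Proof.
move=> fg [[M fM] fu]; split; first by exists M => x Kx; rewrite -fg// fM.
move=> e /fu[d d0 fd]; exists d => // x y Kx Ky xy.
by rewrite -!fg//; exact: fd.
Qed.

Lemma BUCD f g : BUC f -> BUC g -> BUC (fun x => f x + g x).
Proof.
move=> [[M fM] fu] [[M' gM] gu]; split.
  exists (M + M') => x Kx; apply: le_trans (ler_normD _ _) _.
  by apply: lerD; [exact: fM|exact: gM].
move=> e e0; have e2 : 0 < e / 2 by rewrite divr_gt0.
have [d d0 fd] := fu _ e2; have [d' d'0 gd] := gu _ e2.
exists (Num.min d d'); first by rewrite lt_min d0.
move=> x y Kx Ky; rewrite le_min => /andP[xy xy'].
rewrite opprD addrACA; apply: le_trans (ler_normD _ _) _.
by rewrite [leRHS]splitr; apply: lerD; [exact: fd|exact: gd].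
Qed.

Lemma BUCM f g : BUC f -> BUC g -> BUC (fun x => f x * g x).
Proof.
move=> Bf Bg; have [M M0 fM] := BUC_bound Bf; have [M' M'0 gM] := BUC_bound Bg.
have [_ fu] := Bf; have [_ gu] := Bg; split.
  by exists (M * M') => x Kx; rewrite normrM; apply: ler_pM => //; [exact: fM|exact: gM].
move=> e e0; have e2 : 0 < e / 2 / (M + M' + 1) by rewrite !divr_gt0//; lra.
have [d d0 fd] := fu _ e2; have [d' d'0 gd] := gu _ e2.
exists (Num.min d d'); first by rewrite lt_min d0.
move=> x y Kx Ky; rewrite le_min => /andP[xy xy'].
have -> : f x * g x - f y * g y = f x * (g x - g y) + (f x - f y) * g y by ring.
apply: le_trans (ler_normD _ _) _; rewrite !normrM.
have Eh : e / 2 = (M + M' + 1) * (e / 2 / (M + M' + 1)).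
  by rewrite [RHS]mulrC divfK// gt_eqF//; lra.
rewrite [leRHS]splitr; apply: lerD; rewrite Eh.
  apply: ler_pM => //; last exact: gd.
  by apply: le_trans (fM _ Kx) _; lra.
rewrite mulrC; apply: ler_pM => //; last exact: fd.
by apply: le_trans (gM _ Ky) _; lra.
Qed.

Lemma BUCZ c f : BUC f -> BUC (fun x => c * f x).
Proof. by apply: BUCM; exact: BUC_cst. Qed.

Lemma BUC_sum n (F : 'I_n -> V -> R) : (forall i, BUC (F i)) ->
  BUC (fun x => \sum_(i < n) F i x).
Proof.
elim: n F => [|n IH] F BF.
  by apply: (@eq_BUC (fun=> 0)); [move=> x _; rewrite big_ord0|exact: BUC_cst].
apply: (@eq_BUC (fun x => F ord0 x + \sum_(i < n) F (lift ord0 i) x)).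
  by move=> x _; rewrite big_ord_recl.
by apply: BUCD => //; exact: IH.
Qed.

Lemma BUC_p j : BUC (p j).
Proof.
split.
  by exists B => x Kx; rewrite ger0_norm ?p_ge0//; exact: p_le.
move=> eps eps0.
have [e [S [e_ge0 e_sum e_mod]]] := p_dini (@ltr01 R).
have [i e_tail] := tail_sum_small e_ge0 e_sum eps0.
exists (1 * th ^+ i); first by rewrite mulr_gt0 ?exprn_gt0.
move=> x y Kx Ky xy; apply: le_trans (e_mod i j x y Kx Ky xy) _.
by have := e_tail 1%N; rewrite big_ord1 addn0.
Qed.

Lemma BUC_w j f : BUC f -> BUC (f \o w j).
Proof.
move=> [[M fM] fu]; split; first by exists M => x Kx; exact/fM/wK.
move=> e /fu[d d0 fd]; exists d => // x y Kx Ky xy.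
by apply: fd; [exact: wK|exact: wK|apply: le_trans xy; exact: w_nonexp].
Qed.

Lemma BUC_transfer f : BUC f -> BUC (T f).
Proof.
by move=> Bf; apply: BUC_sum => j; apply: BUCM; [exact: BUC_p|exact: BUC_w].
Qed.

Lemma BUC_iter n f : BUC f -> BUC (iter n T f).
Proof. by move=> Bf; elim: n => //= n; exact: BUC_transfer. Qed.

(** * The limit functional *)

Definition lam f := sup [set lo | exists n, forall x, K x ->
  lo * u n x <= iter n T f x].

(** The infimum over [K] of the ratio of [T^n f] to [u n] is nondecreasing in [n], and [lam f] is
    its supremum. Comparing at the later time [N + n] puts every such lower bound below [hi]. *)
Lemma lam_between f lo hi N : (forall n, (N <= n)%N -> between lo hi n f) ->
  lo <= lam f <= hi.
Proof.
move=> bf; have ub : ubound [set lo | exists n, forall x, K x ->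
    lo * u n x <= iter n T f x] hi.
  move=> c [n cn]; have bN := betweenD n (bf N (leqnn N)).
  have /andP[_ h2] := bN x1 Kx1.
  have : c * u (N + n) x1 <= iter (N + n) T f x1.
    rewrite /mass -iter_transferZ !iterD.
    apply: (le_iter_transfer wK p_ge0) => // y Ky.
    by rewrite iter_transferZ; exact: cn.
  rewrite addnC => /le_trans/(_ h2); rewrite ler_pM2r//.
  exact: mass_gt0.
have lo_in : exists n, forall x, K x -> lo * u n x <= iter n T f x.
  by exists N => x Kx; have /andP[] := bf N (leqnn N) x Kx.
apply/andP; split; first by apply: ub_le_sup => //; exists hi.
by apply: ge_sup => //; exists lo.
Qed.

(** The rank [N] is common to the whole family; [ruelle_eigen] relies on this for infinitely many
    functions at once. *)
Lemma lam_cvg_equi M F eta : 0 <= M -> bounded_by M F -> equi F -> 0 < eta ->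
  exists N, forall f n x, F f -> (N <= n)%N -> K x ->
  `|iter n T f x - lam f * u n x| <= eta * u n x.
Proof.
move=> M0 FM Fequi eta0; have [N h] := osc_decay M0 FM Fequi eta0.
exists N => f n x Ff Nn Kx; have [lo [hi [lohi bf]]] := h f Ff.
have /andP[lo_le hi_ge] := lam_between bf.
have /andP[h1 h2] := bf n Nn x Kx; have ux := mass_gt0 n Kx.
by rewrite ler_norml; nra.
Qed.

Lemma lam_cvg f : BUC f -> forall eta, 0 < eta ->
  exists N, forall n x, (N <= n)%N -> K x ->
  `|iter n T f x - lam f * u n x| <= eta * u n x.
Proof.
move=> Bf eta eta0; have [M M0 fM] := BUC_bound Bf.
have [|||N h] := @lam_cvg_equi M [set f] eta M0.
- by move=> _ x -> Kx; exact: fM.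
- by have [_ fu] := Bf => e /fu[d d0 fd]; exists d => // _ x y -> *; exact: fd.
- exact: eta0.
- by exists N => n x; exact: h.
Qed.

(** Identifies [lam f] from the behaviour at the single point [x1]; linearity and the eigenvalue
    relation of [lam] are all read off from it. *)
Lemma lam_unique f c : BUC f -> (forall eta, 0 < eta -> exists N, forall n,
    (N <= n)%N -> `|iter n T f x1 - c * u n x1| <= eta * u n x1) ->
  lam f = c.
Proof.
move=> Bf fc; apply/eqP; rewrite -subr_eq0 -normr_le0; apply/ler_addgt0Pl => e e0.
rewrite addr0; have e2 : 0 < e / 2 by rewrite divr_gt0.
have [N1 h1] := lam_cvg Bf e2; have [N2 h2] := fc _ e2.
have := h1 (maxn N1 N2) x1 (leq_maxl _ _) Kx1.
have := h2 (maxn N1 N2) (leq_maxr _ _).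
set n := maxn N1 N2; have ux := mass_gt0 n Kx1.
move=> a1 a2; rewrite -(ler_pM2r ux).
have -> : `|lam f - c| * u n x1 =
    `|(iter n T f x1 - c * u n x1) - (iter n T f x1 - lam f * u n x1)|.
  rewrite [X in _ = `|X|](_ : _ = (lam f - c) * u n x1); last by ring.
  by rewrite normrM (gtr0_norm ux).
rewrite [leRHS](_ : _ = e / 2 * u n x1 + e / 2 * u n x1); last by field.
by apply: le_trans (ler_normB _ _) _; exact: lerD.
Qed.

Lemma lam1 : lam (fun=> 1) = 1.
Proof.
apply: lam_unique; first exact: BUC_cst.
move=> e e0; exists 0%N => n _.
by rewrite mul1r subrr normr0 mulr_ge0 ?(ltW e0)// u_ge0.
Qed.

Lemma lamD f g : BUC f -> BUC g -> lam (fun x => f x + g x) = lam f + lam g.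
Proof.
move=> Bf Bg; apply: lam_unique; first exact: BUCD.
move=> e e0; have e2 : 0 < e / 2 by rewrite divr_gt0.
have [N1 h1] := lam_cvg Bf e2; have [N2 h2] := lam_cvg Bg e2.
exists (maxn N1 N2) => n; rewrite geq_max => /andP[n1 n2].
rewrite iter_transferD mulrDl opprD addrACA.
apply: le_trans (ler_normD _ _) _.
rewrite [leRHS](_ : _ = e / 2 * u n x1 + e / 2 * u n x1); last by field.
by apply: lerD; [exact: h1|exact: h2].
Qed.

Lemma lamZ c f : BUC f -> lam (fun x => c * f x) = c * lam f.
Proof.
move=> Bf; apply: lam_unique; first exact: BUCZ.
move=> e e0; have c1 : 0 < `|c| + 1 by rewrite ltr_wpDl.
have [N h] := lam_cvg Bf (divr_gt0 e0 c1).
exists N => n Nn; rewrite iter_transferZ -mulrA -mulrBr normrM.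
have ux := mass_gt0 n Kx1.
apply: (@le_trans _ _ ((`|c| + 1) * (e / (`|c| + 1) * u n x1))).
  by apply: ler_pM => //; [lra|exact: h].
by rewrite mulrA [X in X * _]mulrC divfK// gt_eqF.
Qed.

Lemma lam_ge0 f : BUC f -> (forall x, K x -> 0 <= f x) -> 0 <= lam f.
Proof.
move=> Bf f0; apply/ler_addgt0Pl => e e0; have [N h] := lam_cvg Bf e0.
have := h N x1 (leqnn N) Kx1; rewrite ler_norml => /andP[_ h1].
have : 0 <= iter N T f x1.
  apply: le_trans (iter_transfer_ge N f0 Kx1).
  by rewrite mulr_ge0 ?exprn_ge0 ?(ltW c0_gt0)//; exact/f0/iter_wK.
have ux := mass_gt0 N Kx1 => h0.
by rewrite -(pmulr_lge0 _ ux) mulrDl; lra.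
Qed.

Lemma lam_le f g : BUC f -> BUC g -> (forall x, K x -> f x <= g x) ->
  lam f <= lam g.
Proof.
move=> Bf Bg fg; rewrite -subr_ge0 -mulN1r -lamZ// -lamD//; last exact: BUCZ.
apply: lam_ge0; first by apply: BUCD => //; exact: BUCZ.
by move=> x Kx; rewrite mulN1r subr_ge0 fg.
Qed.

(** The limit is taken as the pointwise lower limit, which the Cauchy bound encloses between
    [g n x - eta] and [g n x + eta]. *)
Lemma uniform_cauchy_lim (g : nat -> V -> R) :
  (forall eta, 0 < eta -> exists N, forall n k x, (N <= n)%N -> K x ->
    `|g (n + k)%N x - g n x| <= eta) ->
  exists h, forall eta, 0 < eta -> exists N, forall n x, (N <= n)%N -> K x ->
    `|g n x - h x| <= eta.
Proof.
move=> gC.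
pose P x := [set c | exists N, forall n, (N <= n)%N -> c <= g n x].
exists (fun x => sup (P x)) => eta eta0; have [N gN] := gC _ eta0.
exists N => n x Nn Kx.
have ub : ubound (P x) (g n x + eta).
  move=> c [N' cN']; have := cN' _ (leq_addl n N'); have := gN n N' x Nn Kx.
  by rewrite ler_norml => /andP[]; lra.
have lb : P x (g n x - eta).
  exists n => k /subnKC <-; have := gN n (k - n)%N x Nn Kx.
  by rewrite ler_norml => /andP[]; lra.
have h1 : g n x - eta <= sup (P x) by apply: ub_le_sup => //; exists (g n x + eta).
have h2 : sup (P x) <= g n x + eta by apply: ge_sup => //; exists (g n x - eta).
by rewrite ler_norml; lra.
Qed.

Lemma BUC_uniform_lim (g : nat -> V -> R) h : (forall n, BUC (g n)) ->
  (forall eta, 0 < eta -> exists N, forall n x, (N <= n)%N -> K x ->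
    `|g n x - h x| <= eta) -> BUC h.
Proof.
move=> Bg gh; split.
  have [N hN] := gh _ ltr01; have [M M0 gM] := BUC_bound (Bg N).
  exists (M + 1) => x Kx; have := hN N x (leqnn N) Kx; have := gM x Kx.
  by rewrite !ler_norml => /andP[? ?] /andP[? ?]; lra.
move=> e e0; have e3 : 0 < e / 3 by rewrite divr_gt0.
have [N hN] := gh _ e3; have [_ gu] := Bg N; have [d d0 gd] := gu _ e3.
exists d => // x y Kx Ky xy; have := gd x y Kx Ky xy.
have := hN N x (leqnn N) Kx; have := hN N y (leqnn N) Ky.
by rewrite !ler_norml => /andP[? ?] /andP[? ?] /andP[? ?]; lra.
Qed.

(** * Eigenvalue and eigenfunction *)

Definition rho := lam (T (fun=> 1)).

Lemma rho_gt0 : 0 < rho.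
Proof.
apply: (lt_le_trans b_gt0); rewrite -[b]mulr1 -lam1 -lamZ; last exact: BUC_cst.
apply: lam_le; [exact/BUCZ/BUC_cst|exact/BUC_transfer/BUC_cst|].
by move=> x Kx; have := mass_step_ge 0 Kx.
Qed.

(** [T^n (T f)] is [T^(n+1) f], hence close to [lam f] times [u n.+1]; and [u n.+1 = T^n (T 1)] is
    close to [rho * u n]. *)
Lemma lam_transfer f : BUC f -> lam (T f) = rho * lam f.
Proof.
move=> Bf; apply: lam_unique; first exact: BUC_transfer.
have BT1 := BUC_transfer (BUC_cst 1).
move=> e e0; have lf : 0 < `|lam f| + 1 by rewrite ltr_wpDl.
have [N1 h1] := lam_cvg Bf (divr_gt0 (divr_gt0 e0 (ltr0n R 2)) MB_gt0).
have [N2 h2] := lam_cvg BT1 (divr_gt0 (divr_gt0 e0 (ltr0n R 2)) lf).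
exists (maxn N1 N2) => n; rewrite geq_max => /andP[n1 n2].
have := h1 n.+1 x1 (leqW n1) Kx1; have := h2 n x1 n2 Kx1.
rewrite -/rho -!iterSr -/(mass n.+1).
set U := u n x1; set W := u n.+1 x1; set F := iter n.+1 T f x1 => a1 a2.
have U_gt0 : 0 < U by exact: mass_gt0.
have WU : W <= MB * U.
  rewrite /W /U /mass iterSr -iter_transferZ.
  apply: (le_iter_transfer wK p_ge0) => // y Ky.
  rewrite /transfer mulr1; under eq_bigr do rewrite mulr1; exact: sum_p_le.
have -> : F - rho * lam f * U = (F - lam f * W) + lam f * (W - rho * U) by ring.
rewrite (_ : e * U = e / 2 / MB * (MB * U) +
  (`|lam f| + 1) * (e / 2 / (`|lam f| + 1) * U)); last first.
  by field; rewrite !gt_eqF.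
apply: le_trans (ler_normD _ _) _; apply: lerD.
  apply: le_trans a2 _; apply: ler_wpM2l => //.
  by rewrite ltW// !divr_gt0.
rewrite normrM; apply: ler_pM => //; lra.
Qed.

Lemma lam_iter f n : BUC f -> lam (iter n T f) = rho ^+ n * lam f.
Proof.
move=> Bf; elim: n => [|n IH]; first by rewrite mul1r.
by rewrite iterS lam_transfer ?IH ?exprS ?mulrA//; exact: BUC_iter.
Qed.

(** [lam (u n) = rho ^+ n] lies between the infimum and the supremum of [u n], which bounded
    distortion makes comparable. *)
Lemma mass_rho : exists2 C, 0 < C & forall n x, K x ->
  u n x <= C * rho ^+ n /\ rho ^+ n <= C * u n x.
Proof.
have [C C_gt0 AC] := mass_distortion; exists C => // n x Kx.
have Bu : BUC (u n) by exact/BUC_iter/BUC_cst.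
have lu : lam (u n) = rho ^+ n by rewrite lam_iter ?lam1 ?mulr1//; exact: BUC_cst.
have le1 : A' n <= rho ^+ n.
  rewrite -lu -[A' n]mulr1 -lam1 -lamZ; last exact: BUC_cst.
  apply: lam_le => //; first exact/BUCZ/BUC_cst.
  by move=> y Ky; rewrite mulr1; exact: mass_inf_le.
have le2 : rho ^+ n <= A n.
  rewrite -lu -[A n]mulr1 -lam1 -lamZ; last exact: BUC_cst.
  apply: lam_le => //; first exact/BUCZ/BUC_cst.
  by move=> y Ky; rewrite mulr1; exact: mass_le_sup.
split.
  apply: le_trans (mass_le_sup n Kx) _; apply: le_trans (AC n) _.
  by rewrite ler_pM2l.
apply: le_trans le2 _; apply: le_trans (AC n) _.
by rewrite ler_pM2l//; exact: mass_inf_le.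
Qed.

Lemma iter_transfer_rho : exists2 C, 0 < C & forall f M n x, 0 <= M ->
  (forall y, K y -> f y <= M) -> K x -> iter n T f x <= M * C * rho ^+ n.
Proof.
have [C C_gt0 uC] := mass_rho; exists C => // f M n x M0 fM Kx.
have [h _] := uC n x Kx.
apply: (@le_trans _ _ (M * u n x)); last by rewrite -mulrA ler_wpM2l.
rewrite -iter_transferZ; apply: (le_iter_transfer wK p_ge0) => // y Ky.
by rewrite /= mulr1; exact: fM.
Qed.

(** The normalized masses [z k] form a bounded equicontinuous family with [lam (z k) = 1]. As
    [T^n (z k)] is [u (n + k)] divided by [rho ^+ k], uniform convergence over this family bounds
    [z (n + k) - z n] for all [k] at once; [h] is the uniform limit. *)
Theorem ruelle_eigen : exists h, [/\ BUC h,
  forall x, K x -> 0 < h x,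
  forall x, K x -> T h x = rho * h x,
  lam h = 1 &
  forall f, BUC f -> forall eta, 0 < eta -> exists N, forall n x,
    (N <= n)%N -> K x -> `|rho ^- n * iter n T f x - lam f * h x| <= eta].
Proof.
have [C C_gt0 uC] := mass_rho.
have r0 n : 0 < rho ^+ n by rewrite exprn_gt0// rho_gt0.
pose z n x := u n x / rho ^+ n.
have zE n : z n = fun x => (rho ^+ n)^-1 * u n x.
  by apply/funext => x; rewrite /z mulrC.
have Bu n : BUC (u n) by exact/BUC_iter/BUC_cst.
have Bz n : BUC (z n) by rewrite zE; exact: BUCZ.
have z_le n x : K x -> z n x <= C.
  by move=> Kx; rewrite ler_pdivrMr//; have [] := uC n x Kx.
have z_ge n x : K x -> C^-1 <= z n x.
  by move=> Kx; rewrite ler_pdivlMr// ler_pdivrMl//; have [] := uC n x Kx.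
have z_gt0 n x : K x -> 0 < z n x.
  by move=> Kx; apply: lt_le_trans (z_ge n x Kx); rewrite invr_gt0.
have lamz n : lam (z n) = 1.
  by rewrite zE lamZ// lam_iter ?lam1 ?mulr1 ?mulVf ?gt_eqF//; exact: BUC_cst.
pose F := [set z k | k in [set: nat]].
have FC : bounded_by C F.
  by move=> _ x [n _ <-] Kx; rewrite gtr0_norm ?z_gt0// z_le.
have Fequi : equi F.
  move=> e e0.
  have G1 : bounded_by 1 [set fun=> 1] by move=> _ x -> _; rewrite normr1.
  have Gequi : equi [set fun=> 1].
    by move=> ep ep0; exists 1 => // _ x y -> _ _ _; rewrite subrr normr0 ltW.
  have [d d0 hd] := iter_transfer_equi ler01 G1 Gequi (divr_gt0 e0 C_gt0).
  exists d => // _ x y [n _ <-] Kx Ky xy.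
  rewrite /z -mulrBl normrM normfV [`|rho ^+ n|]gtr0_norm// ler_pdivrMr//.
  apply: le_trans (hd (fun=> 1) n x y erefl Kx Ky xy) _.
  rewrite -mulrA ler_wpM2l ?(ltW e0)// ler_pdivrMl//.
  by have [] := uC n x Kx.
have zC eta : 0 < eta -> exists N, forall n k x, (N <= n)%N -> K x ->
    `|z (n + k)%N x - z n x| <= eta.
  move=> eta0.
  have [N hN] := lam_cvg_equi (ltW C_gt0) FC Fequi (divr_gt0 eta0 C_gt0).
  exists N => n k x Nn Kx.
  have := hN (z k) n x (ex_intro2 _ _ k I erefl) Nn Kx.
  rewrite lamz mul1r zE iter_transferZ -iterD -/(u (n + k)%N) => h1.
  have -> : z (n + k)%N x - z n x =
      ((rho ^+ k)^-1 * u (n + k)%N x - u n x) / rho ^+ n.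
    by rewrite /z exprD; field; rewrite !gt_eqF// rho_gt0.
  rewrite normrM normfV [`|rho ^+ n|]gtr0_norm// ler_pdivrMr//.
  apply: le_trans h1 _; rewrite -mulrA ler_wpM2l ?(ltW eta0)// ler_pdivrMl//.
  by have [] := uC n x Kx.
have [h zh] := uniform_cauchy_lim zC.
have Bh := BUC_uniform_lim Bz zh.
have h_gt0 x : K x -> 0 < h x.
  move=> Kx; have c2 : 0 < C^-1 / 2 by rewrite divr_gt0 ?invr_gt0.
  have [N hN] := zh _ c2; have := hN N x (leqnn N) Kx; have := z_ge N x Kx.
  by rewrite ler_norml => ? /andP[? ?]; lra.
have Th x : K x -> T h x = rho * h x.
  move=> Kx; apply/eqP; rewrite -subr_eq0 -normr_le0.
  apply/ler_addgt0Pl => e e0; rewrite addr0.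
  have Mr : 0 < MB + rho by rewrite addr_gt0// rho_gt0.
  have [N hN] := zh _ (divr_gt0 e0 Mr).
  have Tz : T (z N) x = rho * z N.+1 x.
    rewrite /z massS exprS /transfer mulr_suml mulr_sumr.
    by apply: eq_bigr => j _; field; rewrite !gt_eqF// rho_gt0.
  have -> : T h x - rho * h x =
      (T h x - T (z N) x) + rho * (z N.+1 x - h x) by rewrite Tz; ring.
  apply: le_trans (ler_normD _ _) _.
  have -> : e = MB * (e / (MB + rho)) + rho * (e / (MB + rho)).
    by rewrite -mulrDl mulrC divfK// gt_eqF.
  apply: lerD.
    rewrite /transfer -sumrB; apply: le_trans (ler_norm_sum _ _ _) _.
    apply: (@le_trans _ _ (\sum_(j < m) p j x * (e / (MB + rho)))).
      apply: ler_sum => j _; rewrite -mulrBr normrM ger0_norm ?p_ge0//.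
      apply: ler_wpM2l; first exact: p_ge0.
      by rewrite distrC; apply: hN => //; exact: wK.
    by rewrite -mulr_suml ler_wpM2r ?sum_p_le// ltW// divr_gt0.
  rewrite normrM [`|rho|]gtr0_norm ?rho_gt0// ler_wpM2l ?(ltW rho_gt0)//.
  exact: hN.
have cvg f : BUC f -> forall eta, 0 < eta -> exists N, forall n x,
    (N <= n)%N -> K x -> `|rho ^- n * iter n T f x - lam f * h x| <= eta.
  move=> Bf eta eta0.
  have lf : 0 < `|lam f| + 1 by rewrite ltr_wpDl.
  have e2 : 0 < eta / 2 by rewrite divr_gt0.
  have [N1 h1] := lam_cvg Bf (divr_gt0 e2 C_gt0).
  have [N2 h2] := zh _ (divr_gt0 e2 lf).
  exists (maxn N1 N2) => n x; rewrite geq_max => /andP[n1 n2] Kx.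
  have -> : rho ^- n * iter n T f x - lam f * h x =
     rho ^- n * (iter n T f x - lam f * u n x) + lam f * (z n x - h x).
    by rewrite /z; ring.
  rewrite [leRHS](_ : _ = eta / 2 / C * C +
    (`|lam f| + 1) * (eta / 2 / (`|lam f| + 1))); last first.
    by field; rewrite !gt_eqF.
  apply: le_trans (ler_normD _ _) _; apply: lerD.
    rewrite normrM normfV [`|rho ^+ n|]gtr0_norm// ler_pdivrMl//.
    apply: le_trans (h1 n x n1 Kx) _.
    rewrite mulrCA ler_wpM2l ?(ltW (divr_gt0 e2 C_gt0))// mulrC.
    by have [] := uC n x Kx.
  by rewrite normrM; apply: ler_pM => //; [lra|exact: h2].
exists h; split => //.
have iterh n x : K x -> rho ^- n * iter n T h x = h x.
  move=> Kx; suff -> : iter n T h x = rho ^+ n * h x by rewrite mulKf ?gt_eqF.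
  elim: n x Kx => [|n IH] x Kx; first by rewrite mul1r.
  rewrite transferS exprSr -mulrA -Th// /transfer mulr_sumr.
  by apply: eq_bigr => j _; rewrite (IH _ (wK j Kx)) mulrCA.
(* [rho ^- n * T^n h] is constantly [h] on [K] and also tends to [lam h * h]; compare at [x1], where
   [h] is positive. *)
apply/eqP; rewrite eq_sym -subr_eq0 -normr_le0; apply/ler_addgt0Pl => e e0.
have hx1 := h_gt0 _ Kx1; rewrite addr0.
have [N hN] := cvg h Bh _ (mulr_gt0 e0 hx1).
have := hN N x1 (leqnn N) Kx1; rewrite iterh//.
rewrite (_ : h x1 - lam h * h x1 = (1 - lam h) * h x1); last by ring.
by rewrite normrM [`|h x1|]gtr0_norm// ler_pM2r.
Qed.

Lemma expr_small (r : R) : 0 <= r -> r < 1 -> forall eps, 0 < eps ->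
  exists n, r ^+ n <= eps.
Proof.
move=> r0 r1 eps eps0.
have [i h] := tail_sum_small (fun i => exprn_ge0 i r0)
  (fun n => geometric_sum_le n r0 r1) eps0.
by exists i; have := h 1%N; rewrite big_ord1 addn0.
Qed.

Lemma summable_cauchy (g : nat -> V -> R) (e : nat -> R) S :
  (forall i, 0 <= e i) -> (forall n, \sum_(i < n) e i <= S) ->
  (forall n x, K x -> `|g n.+1 x - g n x| <= e n) ->
  forall eta, 0 < eta -> exists N, forall n k x, (N <= n)%N -> K x ->
    `|g (n + k)%N x - g n x| <= eta.
Proof.
move=> e0 eS ge eta eta0; have [N e_tail] := tail_sum_small e0 eS eta0.
exists N => n k x Nn Kx.
have : `|g (n + k)%N x - g n x| <= \sum_(i < k) e (n + i)%N.
  elim: k => [|k IH]; first by rewrite addn0 subrr normr0 big_ord0.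
  rewrite big_ord_recr addnS -[g _ x](subrK (g (n + k)%N x)) -addrA.
  apply: le_trans (ler_normD _ _) _; rewrite [leRHS]addrC; apply: lerD => //.
  exact: ge.
move=> /le_trans; apply; apply: le_trans (e_tail (n - N + k)%N).
rewrite big_split_ord /= -[leLHS]add0r; apply: lerD; first exact: sumr_ge0.
by under [leRHS]eq_bigr do rewrite addnA subnKC//.
Qed.

(** * Resolvent of the complexified operator *)

Definition transferC (f : V -> R[i]) : V -> R[i] := fun x =>
  (T (fun y => complex.Re (f y)) x +i* T (fun y => complex.Im (f y)) x)%C.

Local Notation normc := Normc.normc.

Lemma normc_le (z : R[i]) : normc z <= `|complex.Re z| + `|complex.Im z|.
Proof.
case: z => s t /=; rewrite -(ger0_norm (addr_ge0 (normr_ge0 s) (normr_ge0 t))).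
rewrite -sqrtr_sqr ler_wsqrtr// sqrrD !real_normK ?num_real// lerD2r lerDl.
by rewrite mulrn_wge0// mulr_ge0.
Qed.

Lemma normc_ge0 (z : R[i]) : 0 <= normc z.
Proof. by case: z => s t /=; exact: sqrtr_ge0. Qed.

Lemma Re_le_normc (z : R[i]) : `|complex.Re z| <= normc z.
Proof. by case: z => s t /=; rewrite -sqrtr_sqr ler_wsqrtr// lerDl sqr_ge0. Qed.

Lemma Im_le_normc (z : R[i]) : `|complex.Im z| <= normc z.
Proof. by case: z => s t /=; rewrite -sqrtr_sqr ler_wsqrtr// lerDr sqr_ge0. Qed.

Lemma normc_transferC f x : K x ->
  normc (transferC f x) <= T (fun y => normc (f y)) x.
Proof.
move=> Kx; rewrite /transferC /transfer.
(* Real and imaginary parts are two separate real sums; the simultaneous induction reassembles them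
   into one complex sum, to which the triangle inequality applies. *)
elim/big_rec3: _ => [|j r3 r2 r1 _ IH]; first by rewrite /= expr0n addr0 sqrtr0.
rewrite (_ : Complex _ _ = ((p j x)%:C * f (w j x) + (r1 +i* r2))%C); last first.
  apply/eqP; rewrite eq_complex; case: (f (w j x)) => c d /=.
  by rewrite !mul0r subr0 addr0 !eqxx.
apply: le_trans (le_normcD _ _) _; apply: lerD => //.
by rewrite Normc.normcM /= expr0n addr0 sqrtr_sqr ger0_norm ?p_ge0.
Qed.

Lemma transferCB f g x :
  transferC (fun y => f y - g y) x = transferC f x - transferC g x.
Proof.
rewrite /transferC; apply/eqP; rewrite eq_complex /=; apply/andP; split; apply/eqP;
  rewrite -[LHS]/(iter 1 T _ x).
  rewrite -[RHS]/(iter 1 T _ x - iter 1 T _ x) -iter_transferB.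
  by congr (iter 1 T _ x); apply/funext => y; case: (f y) (g y) => ? ? [].
rewrite -[RHS]/(iter 1 T _ x - iter 1 T _ x) -iter_transferB.
by congr (iter 1 T _ x); apply/funext => y; case: (f y) (g y) => ? ? [].
Qed.

Definition BUCC f := BUC (fun x => complex.Re (f x)) /\
  BUC (fun x => complex.Im (f x)).

Lemma BUCC_bound f : BUCC f -> exists2 M, 0 <= M & forall x, K x -> normc (f x) <= M.
Proof.
move=> [/BUC_bound[M M0 fM] /BUC_bound[M' M'0 fM']].
exists (M + M'); first exact: addr_ge0.
move=> x Kx; apply: le_trans (normc_le _) _.
by apply: lerD; [exact: fM|exact: fM'].
Qed.

Section Resolvent.
Variable l : R[i].
Hypothesis rho_lt : rho < normc l.

Let l_gt0 : 0 < normc l. Proof. exact: lt_trans rho_gt0 rho_lt. Qed.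

Let l_neq0 : l != 0.
Proof.
by apply/negP => /eqP l0; move: l_gt0; rewrite l0 Normc.normc0 ltxx.
Qed.

Let r := rho / normc l.
Let r_ge0 : 0 <= r. Proof. by rewrite divr_ge0 ?(ltW rho_gt0) ?normc_ge0. Qed.
Let r_lt1 : r < 1. Proof. by rewrite ltr_pdivrMr ?mul1r. Qed.

(** Iterating the inequality between [|l| |f|] and [T |f|] bounds [|l|^n |f|] by [T^n |f|], which is
    of order [rho ^+ n], while [rho] is below [|l|]. *)
Lemma transferC_eigen_eq0 f : BUCC f ->
  (forall x, K x -> l * f x = transferC f x) -> forall x, K x -> f x = 0.
Proof.
move=> /BUCC_bound[M M0 fM] lf x Kx; apply: Normc.eq0_normc.
have [C C_gt0 TC] := iter_transfer_rho.
pose phi y := normc (f y).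
have phi_le n y : K y -> normc l ^+ n * phi y <= iter n T phi y.
  elim: n y => [|n IH] y Ky; first by rewrite mul1r.
  rewrite exprSr -mulrA /phi -Normc.normcM lf//.
  apply: (@le_trans _ _ (normc l ^+ n * T phi y)).
    by rewrite ler_wpM2l ?exprn_ge0 ?normc_ge0// normc_transferC.
  rewrite transferS mulr_sumr; apply: ler_sum => j _.
  rewrite mulrCA; apply: ler_wpM2l; [exact: p_ge0|exact/IH/wK].
apply/eqP; rewrite eq_le normc_ge0 andbT; apply/ler_addgt0Pl => e e0; rewrite addr0.
have MC1 : 0 < M * C + 1 by rewrite ltr_wpDl// mulr_ge0// ltW.
have [n rn] := expr_small r_ge0 r_lt1 (divr_gt0 e0 MC1).
have ln : 0 < normc l ^+ n by rewrite exprn_gt0.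
rewrite -(ler_pM2l ln); apply: le_trans (phi_le n x Kx) _.
apply: le_trans (TC phi M n x M0 fM Kx) _.
rewrite -ler_pdivrMl// mulrCA -exprVn -exprMn [_^-1 * rho]mulrC -/r.
apply: (@le_trans _ _ ((M * C + 1) * (e / (M * C + 1)))).
  by apply: ler_pM => //; [rewrite mulr_ge0// ltW|rewrite exprn_ge0|rewrite lerDl].
by rewrite mulrC divfK// gt_eqF.
Qed.

(** The sum of [l^-(k+1) T^k g] over [k < n], in the recursive form that makes the resolvent
    equation hold up to one step. *)
Fixpoint neumann g n : V -> R[i] :=
  if n is n'.+1 then fun x => l^-1 * (g x + transferC (neumann g n') x) else fun=> 0.

Lemma BUCC_neumann g n : BUCC g -> BUCC (neumann g n).
Proof.
move=> [gR gI]; elim: n => [|n [IR II]]; first by split; exact: BUC_cst.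
have BR := BUCD gR (BUC_transfer IR); have BI := BUCD gI (BUC_transfer II).
split.
  apply: (eq_BUC _ (BUCD (BUCZ (complex.Re l^-1) BR)
                         (BUCZ (- complex.Im l^-1) BI))) => x _ /=.
  by case: (l^-1) (g x) => [a1 a2] [b1 b2] /=; rewrite mulNr.
apply: (eq_BUC _ (BUCD (BUCZ (complex.Re l^-1) BI)
                       (BUCZ (complex.Im l^-1) BR))) => x _ /=.
by case: (l^-1) (g x) => [a1 a2] [b1 b2] /=.
Qed.

Lemma neumann_step g n x : K x -> normc (neumann g n.+1 x - neumann g n x) <=
  normc l ^- n.+1 * iter n T (fun y => normc (g y)) x.
Proof.
elim: n x => [|n IH] x Kx.
  rewrite subr0 -[neumann _ _ _]/(l^-1 * (g x + transferC (fun=> 0) x)).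
  have -> : transferC (fun=> 0) x = 0.
    by rewrite /transferC /transfer /= big1// => j _; rewrite mulr0.
  by rewrite addr0 Normc.normcM Normc.normcV expr1.
rewrite -[neumann g n.+2 x]/(l^-1 * (g x + transferC (neumann g n.+1) x)).
rewrite -[neumann g n.+1 x]/(l^-1 * (g x + transferC (neumann g n) x)).
rewrite -mulrBr opprD addrACA subrr add0r -transferCB Normc.normcM Normc.normcV.
rewrite exprS invfM -mulrA; apply: ler_wpM2l; first by rewrite invr_ge0 normc_ge0.
apply: le_trans (normc_transferC _ Kx) _; rewrite transferS mulr_sumr.
apply: ler_sum => j _; rewrite mulrCA.
by apply: ler_wpM2l; [exact: p_ge0|exact/IH/wK].
Qed.

Theorem transferC_resolvent g : BUCC g ->
  (exists2 f, BUCC f & forall x, K x -> l * f x - transferC f x = g x) /\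
  (forall f1 f2, BUCC f1 -> BUCC f2 ->
    (forall x, K x -> l * f1 x - transferC f1 x = g x) ->
    (forall x, K x -> l * f2 x - transferC f2 x = g x) ->
    forall x, K x -> f1 x = f2 x).
Proof.
move=> Bg; split; last first.
  move=> f1 f2 [f1R f1I] [f2R f2I] e1 e2 x Kx; apply/eqP; rewrite -subr_eq0; apply/eqP.
  apply: (@transferC_eigen_eq0 (fun x => f1 x - f2 x)) => //.
    split.
      apply: (eq_BUC _ (BUCD f1R (BUCZ (-1) f2R))) => y _.
      by case: (f1 y) (f2 y) => [? ?] [? ?] /=; rewrite mulN1r.
    apply: (eq_BUC _ (BUCD f1I (BUCZ (-1) f2I))) => y _.
    by case: (f1 y) (f2 y) => [? ?] [? ?] /=; rewrite mulN1r.
  move=> y Ky; rewrite transferCB; apply/eqP; rewrite mulrBr -subr_eq0; apply/eqP.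
  rewrite [LHS](_ : _ = (l * f1 y - transferC f1 y) - (l * f2 y - transferC f2 y));
    last by ring.
  by rewrite e1// e2// subrr.
have [C C_gt0 TC] := iter_transfer_rho.
have [M M0 gM] := BUCC_bound Bg.
pose e n := M * C / normc l * r ^+ n.
have MCl : 0 <= M * C / normc l by rewrite divr_ge0 ?normc_ge0// mulr_ge0// ltW.
have e_ge0 n : 0 <= e n by rewrite mulr_ge0// exprn_ge0.
have e_sum n : \sum_(i < n) e i <= M * C / normc l * (1 - r)^-1.
  by rewrite -mulr_sumr ler_wpM2l// geometric_sum_le.
have step n x : K x -> normc (neumann g n.+1 x - neumann g n x) <= e n.
  move=> Kx; apply: le_trans (neumann_step g n Kx) _.
  apply: (@le_trans _ _ (normc l ^- n.+1 * (M * C * rho ^+ n))).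
    by rewrite ler_wpM2l ?invr_ge0 ?exprn_ge0 ?normc_ge0// TC.
  rewrite /e /r exprMn exprVn exprS invfM le_eqVlt; apply/orP; left; apply/eqP.
  by ring.
have stepR n x : K x ->
    `|complex.Re (neumann g n.+1 x) - complex.Re (neumann g n x)| <= e n.
  move=> Kx; apply: le_trans (step n x Kx).
  have := Re_le_normc (neumann g n.+1 x - neumann g n x).
  by case: (neumann g n.+1 x) (neumann g n x) => [? ?] [? ?].
have stepI n x : K x ->
    `|complex.Im (neumann g n.+1 x) - complex.Im (neumann g n x)| <= e n.
  move=> Kx; apply: le_trans (step n x Kx).
  have := Im_le_normc (neumann g n.+1 x - neumann g n x).
  by case: (neumann g n.+1 x) (neumann g n x) => [? ?] [? ?].
have [FR hR] := uniform_cauchy_lim (summable_cauchy e_ge0 e_sum stepR).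
have [FI hI] := uniform_cauchy_lim (summable_cauchy e_ge0 e_sum stepI).
have BN n := BUCC_neumann n Bg.
exists (fun x => (FR x +i* FI x)%C).
  split; first exact: (BUC_uniform_lim (fun n => (BN n).1) hR).
  exact: (BUC_uniform_lim (fun n => (BN n).2) hI).
move=> x Kx; set F := fun x => (FR x +i* FI x)%C.
apply/eqP; rewrite -subr_eq0; apply/eqP/Normc.eq0_normc.
apply/eqP; rewrite eq_le normc_ge0 andbT; apply/ler_addgt0Pl => eta eta0.
rewrite addr0; have lM : 0 < 2 * (normc l + MB) by rewrite mulr_gt0// addr_gt0.
have eta1 := divr_gt0 eta0 lM.
have [N1 h1] := hR _ eta1; have [N2 h2] := hI _ eta1.
pose n := maxn N1 N2.
have near k y : (n <= k)%N -> K y ->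
    normc (F y - neumann g k y) <= 2 * (eta / (2 * (normc l + MB))).
  rewrite geq_max => /andP[k1 k2] Ky; apply: le_trans (normc_le _) _.
  have := h1 k y k1 Ky; have := h2 k y k2 Ky.
  rewrite /F; case: (neumann g k y) => s t /= a2 a1.
  by rewrite distrC in a1; rewrite distrC in a2; lra.
(* [l * neumann g n.+1] equals [g] plus the image of [neumann g n], so the defect of [F] involves
   only its distances to two consecutive partial sums. *)
have -> : l * F x - transferC F x - g x =
    l * (F x - neumann g n.+1 x) - transferC (fun y => F y - neumann g n y) x.
  rewrite transferCB mulrBr.
  rewrite -[neumann g n.+1 x]/(l^-1 * (g x + transferC (neumann g n) x)).
  by rewrite mulVKf//; ring.
have -> : eta = normc l * (2 * (eta / (2 * (normc l + MB)))) +
    MB * (2 * (eta / (2 * (normc l + MB)))).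
  by field; rewrite gt_eqF// addr_gt0.
apply: le_trans (le_normcD _ _) _; apply: lerD.
  by rewrite Normc.normcM ler_wpM2l ?normc_ge0// near.
rewrite normcN; apply: le_trans (normc_transferC _ Kx) _.
apply: (@le_trans _ _ (\sum_(j < m) p j x * (2 * (eta / (2 * (normc l + MB)))))).
  by apply: ler_sum => j _; rewrite ler_wpM2l ?p_ge0// near//; exact: wK.
by rewrite -mulr_suml ler_wpM2r ?sum_p_le// mulr_ge0// ltW.
Qed.

End Resolvent.

(** Interface of the section: the functional leaves it as an abstract [la] with the positivity,
    linearity and normalization that the Riesz representation asks for. *)
Theorem ruelle_core : exists (rh : R) (la : (V -> R) -> R) (h : V -> R),
  [/\ 0 < rh, BUC h, (forall x, K x -> 0 < h x),
      (forall x, K x -> T h x = rh * h x) & la h = 1] /\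
  [/\ la (fun=> 1) = 1,
      (forall f g, BUC f -> BUC g -> la (fun x => f x + g x) = la f + la g),
      (forall c f, BUC f -> la (fun x => c * f x) = c * la f),
      (forall f, BUC f -> (forall x, K x -> 0 <= f x) -> 0 <= la f) &
      (forall f, BUC f -> BUC (T f) /\ la (T f) = rh * la f)] /\
  (forall f, BUC f -> forall eta, 0 < eta -> exists N, forall n x, (N <= n)%N ->
     K x -> `|rh ^- n * iter n T f x - la f * h x| <= eta) /\
  (forall l : R[i], rh < normc l -> forall g, BUCC g ->
     (exists2 f, BUCC f & forall x, K x -> l * f x - transferC f x = g x) /\
     (forall f1 f2, BUCC f1 -> BUCC f2 ->
       (forall x, K x -> l * f1 x - transferC f1 x = g x) ->
       (forall x, K x -> l * f2 x - transferC f2 x = g x) ->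
       forall x, K x -> f1 x = f2 x)).
Proof.
have [h [Bh h_gt0 Th lamh cvg]] := ruelle_eigen.
exists rho, lam, h; split; first by split=> //; exact: rho_gt0.
split; last by split => // l; exact: transferC_resolvent.
split; [exact: lam1|exact: lamD|exact: lamZ|exact: lam_ge0|].
by move=> f Bf; split; [exact: BUC_transfer|exact: lam_transfer].
Qed.

End Distortion.

(** * Riesz representation on a compact set *)

Section Riesz.
Variables (R : realType) (T : pointedType) (K : set T).
Variables (CC : set (T -> R)) (Lam : (T -> R) -> R).
Hypothesis CC_cst : forall c, CC (fun=> c).
Hypothesis CCD : forall f g, CC f -> CC g -> CC (fun x => f x + g x).
Hypothesis CCM : forall f g, CC f -> CC g -> CC (fun x => f x * g x).
Hypothesis Lam1 : Lam (fun=> 1) = 1.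
Hypothesis LamD : forall f g, CC f -> CC g ->
  Lam (fun x => f x + g x) = Lam f + Lam g.
Hypothesis LamZ : forall c f, CC f -> Lam (fun x => c * f x) = c * Lam f.
Hypothesis Lam_ge0 : forall f, CC f -> (forall x, K x -> 0 <= f x) -> 0 <= Lam f.
Hypothesis dini : forall g : nat -> T -> R, (forall n, CC (g n)) ->
  (forall n k x, (n <= k)%N -> K x -> g n x <= g k x) ->
  (forall x, K x -> exists n, 1 <= g n x) ->
  forall eps, 0 < eps -> exists n, forall x, K x -> 1 - eps <= g n x.

Let CCZ c f : CC f -> CC (fun x => c * f x).
Proof. by apply: CCM. Qed.

Let CCB f g : CC f -> CC g -> CC (fun x => f x - g x).
Proof.
move=> Cf Cg; have -> : (fun x => f x - g x) = (fun x => f x + -1 * g x).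
  by apply/funext => x; rewrite mulN1r.
by apply: CCD => //; exact: CCZ.
Qed.

Let LamB f g : CC f -> CC g -> Lam (fun x => f x - g x) = Lam f - Lam g.
Proof.
move=> Cf Cg; have -> : (fun x => f x - g x) = (fun x => f x + -1 * g x).
  by apply/funext => x; rewrite mulN1r.
by rewrite LamD ?LamZ ?mulN1r//; exact: CCZ.
Qed.

Let Lam_le f g : CC f -> CC g -> (forall x, K x -> f x <= g x) -> Lam f <= Lam g.
Proof.
move=> Cf Cg fg; rewrite -subr_ge0 -LamB//; apply: Lam_ge0; first exact: CCB.
by move=> x Kx; rewrite subr_ge0 fg.
Qed.

Let CC_sum n (F : nat -> T -> R) : (forall i, CC (F i)) ->
  CC (fun x => \sum_(i < n) F i x) /\
  Lam (fun x => \sum_(i < n) F i x) = \sum_(i < n) Lam (F i).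
Proof.
move=> CF; elim: n => [|n [IH1 IH2]].
  have -> : (fun x => \sum_(i < 0) F i x) = (fun=> 0).
    by apply/funext => x; rewrite big_ord0.
  split; first exact: CC_cst.
  by rewrite big_ord0 -[X in Lam (fun=> X)](mul0r (1 : R)) LamZ// mul0r.
have -> : (fun x => \sum_(i < n.+1) F i x) =
    (fun x => (\sum_(i < n) F i x) + F n x).
  by apply/funext => x; rewrite big_ord_recr.
split; first exact: CCD.
by rewrite LamD// IH2 big_ord_recr.
Qed.

(* Nondecreasing sequences make the countable subadditivity of the outer
   measure elementary: no exchange of limits is involved. *)
Definition cover_by (A : set T) (t : R) (g : nat -> T -> R) :=
  [/\ forall n, CC (g n),
      forall n x, K x -> 0 <= g n x,
      forall n k x, (n <= k)%N -> K x -> g n x <= g k x,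
      forall n, Lam (g n) <= t &
      forall x, A x -> K x -> exists n, 1 <= g n x].

Definition covered A := [set t | exists g, cover_by A t g].

Definition rmu A := inf (covered A).

Lemma covered_ge0 A t : covered A t -> 0 <= t.
Proof.
by move=> [g [Cg g0 _ gt _]]; apply: le_trans (gt 0%N); apply: Lam_ge0 => // x; exact: g0.
Qed.

Lemma coveredT A : covered A 1.
Proof.
exists (fun _ _ => 1); split => //; first by move=> n; rewrite Lam1.
by move=> x _ _; exists 0%N.
Qed.

Lemma covered_const A f : CC f -> (forall x, K x -> 0 <= f x) ->
  (forall x, A x -> K x -> 1 <= f x) -> covered A (Lam f).
Proof.
move=> Cf f0 f1; exists (fun=> f); split => //.
by move=> x Ax Kx; exists 0%N; exact: f1.
Qed.

Let covered_inf A : has_inf (covered A).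
Proof.
split; first by exists 1; exact: coveredT.
by exists 0 => t; exact: covered_ge0.
Qed.

Lemma rmu_le A t : covered A t -> rmu A <= t.
Proof. by move=> At; apply: ge_inf => //; case: (covered_inf A). Qed.

Lemma rmu_ge0 A : 0 <= rmu A.
Proof.
by apply: lb_le_inf; [case: (covered_inf A)|move=> t; exact: covered_ge0].
Qed.

Lemma covered_sub A B t : A `<=` B -> covered B t -> covered A t.
Proof.
move=> AB [g [Cg g0 gm gt g1]]; exists g; split => // x Ax; exact/g1/AB.
Qed.

Lemma le_rmu A B : A `<=` B -> rmu A <= rmu B.
Proof.
move=> AB; apply: lb_le_inf; first by case: (covered_inf B).
by move=> t Bt; apply: rmu_le; exact: covered_sub Bt.
Qed.

(** Covers are tested on [K] only; this is why the measure gives [K] full mass. *)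
Lemma rmuI A : rmu (A `&` K) = rmu A.
Proof.
apply/eqP; rewrite eq_le; apply/andP; split; first by apply: le_rmu => x [].
apply: lb_le_inf; first by case: (covered_inf (A `&` K)).
move=> t [g [Cg g0 gm gt g1]]; apply: rmu_le; exists g; split => // x Ax Kx.
exact: g1.
Qed.

(** Compactness enters in the lower bound: by Dini's theorem a cover of everything reaches [1 - e]
    on all of [K] at some finite stage. *)
Lemma rmuT : rmu setT = 1.
Proof.
apply/eqP; rewrite eq_le; apply/andP; split; first exact/rmu_le/coveredT.
apply: lb_le_inf; first by case: (covered_inf setT).
move=> t [g [Cg g0 gm gt g1]]; apply/ler_addgt0Pl => e e0.
have [n gn] := dini Cg gm (fun x => g1 x I) e0.
have : Lam (fun=> (1 - e) * 1) <= Lam (g n).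
  apply: Lam_le; [exact: CC_cst|exact: Cg|move=> x Kx].
  by rewrite mulr1; exact: gn.
rewrite LamZ; last exact: CC_cst.
by rewrite Lam1 mulr1; have := gt n; lra.
Qed.

Definition emu (A : set T) : \bar R := (rmu A)%:E.

Lemma emu0 : emu set0 = 0%E.
Proof.
congr (_%:E); apply/eqP; rewrite eq_le rmu_ge0 andbT.
have -> : 0 = Lam (fun=> 0 * 1) by rewrite LamZ// mul0r.
by apply: rmu_le; apply: covered_const => // x _; rewrite mul0r.
Qed.

Lemma emu_ge0 A : (0 <= emu A)%E. Proof. by rewrite lee_fin rmu_ge0. Qed.

Lemma le_emu : {homo emu : A B / A `<=` B >-> (A <= B)%E}.
Proof. by move=> A B AB; rewrite lee_fin le_rmu. Qed.

Let half_sum n (e : R) : \sum_(k < n) e / 2 ^+ k.+1 = e - e / 2 ^+ n.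
Proof.
elim: n => [|n IH]; first by rewrite big_ord0 expr0 divr1 subrr.
rewrite big_ord_recr /= IH exprS; field.
by rewrite expf_neq0.
Qed.

(** The union is covered by diagonal sums: at stage [n], the first [n.+1] covers, each at its own
    stage [n]. They are nondecreasing in [n] and never cost more than [s + e]. *)
Lemma emu_sigma_subadditive : sigma_subadditive emu.
Proof.
move=> F; have [->|sfin] := eqVneq (\sum_(i <oo) emu (F i))%E +oo%E.
  by rewrite leey.
have s_ge0 : (0 <= \sum_(i <oo) emu (F i))%E.
  by apply: nneseries_ge0 => n _ _; exact: emu_ge0.
have s_fin : (\sum_(i <oo) emu (F i))%E \is a fin_num.
  by rewrite ge0_fin_numE// ltey.
rewrite -(fineK s_fin) lee_fin; set s := fine _.
have sumF n : \sum_(i < n) rmu (F i) <= s.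
  rewrite -lee_fin fineK// -sumEFin -(big_mkord xpredT (fun i => emu (F i))).
  by apply: nneseries_lim_ge => k _ _; exact: emu_ge0.
apply/ler_addgt0Pl => e e0.
have [g gP] : {g : nat -> nat -> T -> R &
    forall k, exists2 t, t < rmu (F k) + e / 2 ^+ k.+1 & cover_by (F k) t (g k)}.
  apply: (@choice _ _ (fun k g =>
    exists2 t, t < rmu (F k) + e / 2 ^+ k.+1 & cover_by (F k) t g)) => k.
  have ek : 0 < e / 2 ^+ k.+1 by rewrite divr_gt0// exprn_gt0.
  by have [t [g gt] tlt] := inf_adherent ek (covered_inf (F k)); exists g, t.
have Cg k n : CC (g k n) by have [t _ []] := gP k.
have g_ge0 k n x : K x -> 0 <= g k n x.
  by have [t _ [_ g0 _ _ _]] := gP k; exact: g0.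
have g_mono k n n' x : (n <= n')%N -> K x -> g k n x <= g k n' x.
  by have [t _ [_ _ gm _ _]] := gP k; exact: gm.
apply: rmu_le; exists (fun n x => \sum_(k < n.+1) g k n x); split.
- by move=> n; have [] := CC_sum n.+1 (F := fun k => g k n) (fun k => Cg k n).
- by move=> n x Kx; apply: sumr_ge0 => k _; exact: g_ge0.
- move=> n k x nk Kx; rewrite -(subnKC nk) -addSn big_split_ord /= -[leLHS]addr0.
  apply: lerD; last by apply: sumr_ge0 => i _; exact: g_ge0.
  by apply: ler_sum => i _; apply: g_mono => //; exact: leq_addr.
- move=> n; have [_ ->] := CC_sum n.+1 (F := fun k => g k n) (fun k => Cg k n).
  apply: (@le_trans _ _ (\sum_(k < n.+1) (rmu (F k) + e / 2 ^+ k.+1))).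
    apply: ler_sum => k _; have [t tlt [_ _ _ gt _]] := gP k.
    exact: le_trans (gt n) (ltW tlt).
  rewrite big_split /= half_sum; have := sumF n.+1.
  have : 0 <= e / 2 ^+ n.+1 by rewrite divr_ge0 ?(ltW e0)// exprn_ge0.
  by lra.
move=> x [k _ Fkx] Kx; have [t _ [_ _ _ _ g1]] := gP k.
have [n gn] := g1 x Fkx Kx; exists (maxn k n).
have kn : (k < (maxn k n).+1)%N by rewrite ltnS leq_maxl.
rewrite (bigD1 (Ordinal kn))//= -[leLHS]addr0; apply: lerD.
  by apply: le_trans gn _; apply: g_mono => //; exact: leq_maxr.
by apply: sumr_ge0 => i _; exact: g_ge0.
Qed.

HB.instance Definition _ := isOuterMeasure.Build R T emu
  emu0 emu_ge0 le_emu emu_sigma_subadditive.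

Definition riesz_outer : {outer_measure set T -> \bar R} := emu.

(** On [K] the [phi k] increase to the indicator of [U]. A cover [g] of [X] splits into
    [g n * phi n], covering the part inside [U] at cost [sup P], and a multiple of [1 - phi k],
    covering the part outside at cost [t - Lam (g k * phi k)]; the supremum over [k] makes the two
    costs add up to at most [t]. *)
Lemma emu_caratheodory (U : set T) (phi : nat -> T -> R) :
  (forall k, CC (phi k)) ->
  (forall k x, K x -> 0 <= phi k x <= 1) ->
  (forall n k x, (n <= k)%N -> K x -> phi n x <= phi k x) ->
  (forall k x, K x -> ~ U x -> phi k x = 0) ->
  (forall x, K x -> U x -> exists k, phi k x = 1) ->
  emu.-caratheodory U.
Proof.
move=> Cphi phi01 phi_mono phi0 phi1; apply: le_caratheodory_measurable => X.
rewrite -EFinD lee_fin; apply: lb_le_inf; first by case: (covered_inf X).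
move=> t [g [Cg g0 gm gt g1]].
have gphi_le k n x : K x -> (k <= n)%N -> g k x * phi k x <= g n x * phi n x.
  move=> Kx kn; have /andP[p0 p1] := phi01 k x Kx.
  by apply: ler_pM => //; [exact: g0|exact: gm|exact: phi_mono].
pose P := [set Lam (fun x => g n x * phi n x) | n in [set: nat]].
have outside k : rmu (X `&` ~` U) <= t - Lam (fun x => g k x * phi k x).
  (* With [maxn n k], the subtracted [g (maxn n k) * phi k] dominates [g k * phi k] at every stage,
     so one bound on the cost serves all [n]. *)
  apply: rmu_le; exists (fun n x => g (maxn n k) x * (1 - phi k x)).
  have phik x : K x -> 0 <= 1 - phi k x.
    by move=> Kx; have /andP[_ ?] := phi01 k x Kx; rewrite subr_ge0.
  split.
  - by move=> n; apply: CCM => //; exact: CCB.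
  - by move=> n x Kx; rewrite mulr_ge0 ?g0 ?phik.
  - move=> n n' x nn' Kx; apply: ler_wpM2r; first exact: phik.
    by apply: gm => //; rewrite geq_max !leq_max nn' leqnn orbT.
  - move=> n; have -> : (fun x => g (maxn n k) x * (1 - phi k x)) =
        (fun x => g (maxn n k) x - g (maxn n k) x * phi k x).
      by apply/funext => x; rewrite mulrBr mulr1.
    rewrite LamB//; last exact: CCM.
    apply: lerB; first exact: gt.
    apply: Lam_le; [exact: CCM|exact: CCM|move=> x Kx].
    have /andP[p0 _] := phi01 k x Kx.
    by apply: ler_wpM2r => //; apply: gm => //; exact: leq_maxr.
  move=> x [Xx nUx] Kx; have [n gn] := g1 x Xx Kx; exists n.
  rewrite phi0// subr0 mulr1; apply: le_trans gn _.
  by apply: gm => //; exact: leq_maxl.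
have P_ub : ubound P (t - rmu (X `&` ~` U)).
  by move=> _ [k _ <-]; have := outside k; lra.
have P_sup : sup P <= t - rmu (X `&` ~` U).
  by apply: ge_sup => //; exists (Lam (fun x => g 0%N x * phi 0%N x)), 0%N.
suff : rmu (X `&` U) <= sup P by move: P_sup; lra.
apply: rmu_le; exists (fun n x => g n x * phi n x); split.
- by move=> n; exact: CCM.
- by move=> n x Kx; have /andP[p0 _] := phi01 n x Kx; rewrite mulr_ge0 ?g0.
- by move=> n k x nk Kx; exact: gphi_le.
- by move=> n; apply: ub_le_sup; [exists (t - rmu (X `&` ~` U))|exists n].
move=> x [Xx Ux] Kx; have [n gn] := g1 x Xx Kx; have [k phik] := phi1 x Kx Ux.
exists (maxn n k); rewrite -[leLHS]mulr1; apply: ler_pM => //.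
  by apply: le_trans gn _; apply: gm => //; exact: leq_maxl.
by rewrite -phik; apply: phi_mono => //; exact: leq_maxr.
Qed.

End Riesz.

(** * Integration against the constructed measure *)

Lemma slice_bounds (R : realType) (v a del : R) : 0 < del ->
  let s := Num.max (v - a) 0 - Num.max (v - (a + del)) 0 in
  [/\ 0 <= s, s <= del, a + del <= v -> s = del & v <= a -> s = 0].
Proof.
move=> del0 /=; rewrite !maxEle.
by case: ifPn; rewrite -?ltNge => h1; case: ifPn; rewrite -?ltNge => h2; split; lra.
Qed.

Section RieszIntegral.
Variables (R : realType) (d : measure_display) (T : measurableType d).
Variables (mu : probability T R) (K : set T).
Variables (CC : set (T -> R)) (Lam : (T -> R) -> R).
Hypothesis mK : measurable K.
Hypothesis muK : mu K = 1%E.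
Hypothesis CC_meas : forall f, CC f -> measurable_fun K f.
Hypothesis CC_bound : forall f, CC f -> exists M : R, forall x, K x -> `|f x| <= M.

Local Notation I f := (\int[mu]_(x in K) f x).

Lemma bounded_integrable (f : T -> R) (M : R) : measurable_fun K f ->
  (forall x, K x -> `|f x| <= M) -> mu.-integrable K (EFin \o f).
Proof.
move=> mf fM; apply: measurable_bounded_integrable => //.
  by apply: (@le_lt_trans _ _ 1%E); [exact: probability_le1|exact: ltry].
by exists M; split; rewrite ?num_real // => M' MM' x Kx; exact: le_trans (fM x Kx) (ltW MM').
Qed.

Lemma CC_integrable f : CC f -> mu.-integrable K (EFin \o f).
Proof.
by move=> Cf; have [M fM] := CC_bound Cf; apply: bounded_integrable fM; exact: CC_meas.
Qed.

Lemma Rintegral_K_cst c : I (fun=> c) = c.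
Proof.
rewrite Rintegral_cst//; have -> : fine (mu K) = 1 by rewrite muK.
by rewrite mulr1.
Qed.

Lemma Rintegral_sum_indic c (A : nat -> set T) n :
  (forall i, measurable (A i)) ->
  mu.-integrable K (EFin \o (fun x => \sum_(i < n) c * \1_(A i) x)) /\
  I (fun x => \sum_(i < n) c * \1_(A i) x) = \sum_(i < n) c * fine (mu (A i `&` K)).
Proof.
move=> mA; have int1 i : mu.-integrable K (EFin \o (\1_(A i) : T -> R)).
  apply: (@bounded_integrable _ 1); first exact: measurable_indic.
  by move=> x _; rewrite indicE; case: (_ \in _); rewrite ?normr1 ?normr0.
have intc i : mu.-integrable K (EFin \o (fun x => c * \1_(A i) x)).
  exact: integrableZl (int1 i).
elim: n => [|n [IH1 IH2]].
  have -> : (fun x => \sum_(i < 0) c * \1_(A i) x) = (fun=> 0 : R).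
    by apply/funext => x; rewrite big_ord0.
  split; last by rewrite Rintegral_K_cst big_ord0.
  by apply: (@bounded_integrable _ 0) => // x _; rewrite normr0.
have -> : (fun x => \sum_(i < n.+1) c * \1_(A i) x) =
    (fun x => (\sum_(i < n) c * \1_(A i) x) + c * \1_(A n) x).
  by apply/funext => x; rewrite big_ord_recr.
split; first exact: integrableD IH1 (intc n).
rewrite RintegralD// IH2 big_ord_recr /=; congr (_ + _).
by rewrite RintegralZl//; congr (_ * _); rewrite /Rintegral integral_indic.
Qed.

Hypothesis CC_cst : forall c, CC (fun=> c).
Hypothesis CCD : forall f g, CC f -> CC g -> CC (fun x => f x + g x).
Hypothesis CCM : forall f g, CC f -> CC g -> CC (fun x => f x * g x).
Hypothesis CC_max0 : forall f, CC f -> CC (fun x => Num.max (f x) 0).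
Hypothesis Lam1 : Lam (fun=> 1) = 1.
Hypothesis LamD : forall f g, CC f -> CC g ->
  Lam (fun x => f x + g x) = Lam f + Lam g.
Hypothesis LamZ : forall c f, CC f -> Lam (fun x => c * f x) = c * Lam f.
Hypothesis eq_Lam : forall f g, CC f -> CC g -> (forall x, K x -> f x = g x) ->
  Lam f = Lam g.
Hypothesis mu_le : forall (A : set T) f, measurable A -> CC f ->
  (forall x, K x -> 0 <= f x) -> (forall x, A x -> K x -> 1 <= f x) ->
  (mu A <= (Lam f)%:E)%E.

Let CCZ c f : CC f -> CC (fun x => c * f x).
Proof. by apply: CCM. Qed.

Let CCB f g : CC f -> CC g -> CC (fun x => f x - g x).
Proof.
move=> Cf Cg; have -> : (fun x => f x - g x) = (fun x => f x + -1 * g x).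
  by apply/funext => x; rewrite mulN1r.
by apply: CCD => //; exact: CCZ.
Qed.

Let LamB f g : CC f -> CC g -> Lam (fun x => f x - g x) = Lam f - Lam g.
Proof.
move=> Cf Cg; have -> : (fun x => f x - g x) = (fun x => f x + -1 * g x).
  by apply/funext => x; rewrite mulN1r.
by rewrite LamD ?LamZ ?mulN1r//; exact: CCZ.
Qed.

Let CC_sum n (F : nat -> T -> R) : (forall i, CC (F i)) ->
  CC (fun x => \sum_(i < n) F i x) /\
  Lam (fun x => \sum_(i < n) F i x) = \sum_(i < n) Lam (F i).
Proof.
move=> CF; elim: n => [|n [IH1 IH2]].
  have -> : (fun x => \sum_(i < 0) F i x) = (fun=> 0).
    by apply/funext => x; rewrite big_ord0.
  split; first exact: CC_cst.
  by rewrite big_ord0 -[X in Lam (fun=> X)](mul0r (1 : R)) LamZ// mul0r.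
have -> : (fun x => \sum_(i < n.+1) F i x) =
    (fun x => (\sum_(i < n) F i x) + F n x).
  by apply/funext => x; rewrite big_ord_recr.
split; first exact: CCD.
by rewrite LamD// IH2 big_ord_recr.
Qed.

Let Lam_ge0 f : CC f -> (forall x, K x -> 0 <= f x) -> 0 <= Lam f.
Proof.
move=> Cf f0; have : (mu set0 <= (Lam f)%:E)%E by apply: mu_le.
by rewrite measure0 lee_fin.
Qed.

(* The slices max(f - i/N, 0) - max(f - (i+1)/N, 0) sum up to f, and N times the
   i-th slice dominates the indicator function of {f >= (i+1)/N}. *)
Lemma Rintegral_le_Lam f : CC f -> (forall x, K x -> 0 <= f x <= 1) ->
  I f <= Lam f.
Proof.
move=> Cf f01; apply/ler_addgt0Pl => e e0.
have [n ne] : exists n, e^-1 < n%:R.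
  by exists (Num.bound e^-1); apply: archi_boundP; rewrite invr_ge0 ltW.
pose N : R := n.+1%:R.
have N_gt0 : 0 < N by rewrite ltr0n.
have N_le : N^-1 <= e.
  rewrite invf_ple ?posrE// ltW//; apply: lt_le_trans ne _.
  by rewrite ler_nat.
pose top i x := Num.max (f x - i%:R / N) 0.
pose psi i x := top i x - top i.+1 x.
have Ctop i : CC (top i) by apply: CC_max0; exact: CCB.
have Cpsi i : CC (psi i) by exact: CCB.
have iS i : i.+1%:R / N = i%:R / N + N^-1 :> R by rewrite -natr1 mulrDl mul1r.
have N1_gt0 : 0 < N^-1 by rewrite invr_gt0.
have psi_slice i x : [/\ 0 <= psi i x, psi i x <= N^-1,
    i.+1%:R / N <= f x -> psi i x = N^-1 & f x <= i%:R / N -> psi i x = 0].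
  by rewrite /psi /top iS; exact: slice_bounds.
have psi_ge0 i x : 0 <= psi i x by have [] := psi_slice i x.
have psi_le i x : psi i x <= N^-1 by have [] := psi_slice i x.
have psi_top i x : i.+1%:R / N <= f x -> psi i x = N^-1.
  by have [_ _ h _] := psi_slice i x.
have psi_bot i x : f x <= i%:R / N -> psi i x = 0.
  by have [_ _ _ h] := psi_slice i x.
have sum_psi x : K x -> f x = \sum_(i < n.+1) psi i x.
  move=> Kx; have /andP[fx0 fx1] := f01 x Kx.
  have sumE k : \sum_(i < k) psi i x = top 0%N x - top k x.
    elim: k => [|k IH]; first by rewrite big_ord0 subrr.
    by rewrite big_ord_recr /= IH /psi; ring.
  rewrite sumE /top mul0r subr0 divff ?gt_eqF// max_l// max_r ?subr0//.
  by rewrite subr_le0.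
pose A i := K `&` [set x | i.+1%:R / N <= f x].
have mA i : measurable (A i).
  have := CC_meas Cf mK (measurable_itv `[i.+1%:R / N, +oo[).
  congr (measurable _); apply/seteqP; split => x [Kx]/=; rewrite in_itv/= andbT;
  by split.
have [intS IS] := Rintegral_sum_indic N^-1 n mA.
pose G x := N^-1 + \sum_(i < n) N^-1 * \1_(A i) x.
have intN : mu.-integrable K (EFin \o (fun=> N^-1 : R)).
  by apply: CC_integrable; exact: CC_cst.
(* Slice 0 is at most [N^-1], and slice [i.+1] vanishes outside [A i]. This shift by one costs only
   the error [N^-1]. *)
have fG x : K x -> f x <= G x.
  move=> Kx; rewrite (sum_psi x Kx) big_ord_recl /G; apply: lerD => //.
  apply: ler_sum => i _; rewrite lift0.
  have [Ai|nAi] := pselect (A i x).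
    by rewrite indicE mem_set// mulr1.
  rewrite psi_bot; first by rewrite mulr_ge0// ltW.
  by rewrite leNgt; apply/negP => h; apply: nAi; split => //=; exact: ltW.
have : I f <= I G.
  apply: le_Rintegral => //; [exact: CC_integrable|exact: integrableD intN intS].
move=> /le_trans; apply; rewrite RintegralD// Rintegral_K_cst IS.
apply: lerD => //.
have [Cs Ls] := CC_sum n.+1 Cpsi.
rewrite (eq_Lam Cf Cs sum_psi) Ls big_ord_recr /= -[leLHS]addr0.
apply: lerD; last exact: Lam_ge0.
apply: ler_sum => i _; rewrite ler_pdivrMl// -LamZ//.
have mAK : measurable (A i `&` K) by exact: measurableI.
rewrite -lee_fin fineK ?fin_num_measure//; apply: mu_le => //.
- exact: CCZ.
- by move=> x _; rewrite mulr_ge0// ltW.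
by move=> x [[_ /psi_top ->] _] _; rewrite divff// gt_eqF.
Qed.

(** For values in [[0, 1]], the inequality applied to [1 - g] gives the converse one. A general [f]
    is brought into that range by an affine change; the [+ 1] in [c] keeps the divisor positive. *)
Theorem Rintegral_Lam f : CC f -> I f = Lam f.
Proof.
move=> Cf.
have h01 g : CC g -> (forall x, K x -> 0 <= g x <= 1) -> I g = Lam g.
  move=> Cg g01; apply/eqP; rewrite eq_le Rintegral_le_Lam//=.
  have C1g : CC (fun x => 1 - g x) by exact: CCB.
  have : I (fun x => 1 - g x) <= Lam (fun x => 1 - g x).
    by apply: Rintegral_le_Lam => // x /g01; lra.
  rewrite RintegralB//; [|exact: CC_integrable|exact: CC_integrable].
  by rewrite Rintegral_K_cst LamB// Lam1; lra.
have [M fM] := CC_bound Cf.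
pose c := 2 * `|M| + 1; have c_gt0 : 0 < c by rewrite ltr_wpDl// mulr_ge0.
pose g x := c^-1 * (f x + `|M|).
have Cfm : CC (fun x => f x + `|M|) by exact: CCD.
have Cg : CC g by exact: CCZ.
have : I g = Lam g.
  apply: h01 => // x Kx; have := fM x Kx; rewrite ler_norml => /andP[f1 f2].
  have := ler_norm M => hM; rewrite /g; apply/andP; split.
    by rewrite mulr_ge0 ?invr_ge0 ?(ltW c_gt0)//; lra.
  by rewrite mulrC ler_pdivrMr// /c; lra.
rewrite /g RintegralZl//; last exact: CC_integrable.
rewrite LamZ// => /mulfI; rewrite invr_eq0 gt_eqF// => /(_ isT).
rewrite RintegralD//; [|exact: CC_integrable|exact: CC_integrable].
rewrite Rintegral_K_cst LamD//.
have -> : Lam (fun=> `|M|) = `|M|.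
  by rewrite -[X in Lam (fun=> X)]mulr1 LamZ// Lam1 mulr1.
by move/addIr.
Qed.

End RieszIntegral.

(** * Continuous functions on a compact subset of R^d *)

Section EuclideanNorm.
Variables (R : realType) (d : nat).
Implicit Types x y : 'rV[R]_d.

Lemma enorm_ge0 x : 0 <= enorm x.
Proof. exact: sqrtr_ge0. Qed.

Lemma norm_le_enorm x : `|x| <= enorm x.
Proof.
rewrite -[`|x|]/(mx_norm x) mx_normrE; apply/bigmax_leP; split.
  exact: enorm_ge0.
move=> [i j] _ /=; rewrite (ord1 i) -sqrtr_sqr ler_wsqrtr//.
by rewrite (bigD1 j)//= lerDl; apply: sumr_ge0 => k _; exact: sqr_ge0.
Qed.

Lemma coord_le_norm x j : `|x ord0 j| <= `|x|.
Proof.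
rewrite -[`|x|]/(mx_norm x) mx_normrE.
exact: (le_bigmax _ (fun ij : 'I_1 * 'I_d => `|x ij.1 ij.2|) (ord0, j)).
Qed.

(** The constant is crude, but [d.+1] is positive also in dimension 0, so later radii can be divided
    by it. *)
Lemma enorm_le_norm x : enorm x <= d.+1%:R * `|x|.
Proof.
have dx : 0 <= d.+1%:R * `|x| by rewrite mulr_ge0.
rewrite -(ger0_norm dx) -sqrtr_sqr ler_wsqrtr//.
apply: (@le_trans _ _ (\sum_(i < d) `|x| ^+ 2)).
  apply: ler_sum => i _; rewrite -real_normK ?num_real//.
  by rewrite lerXn2r ?nnegrE// coord_le_norm.
rewrite sumr_const card_ord -[leLHS]mulr_natl exprMn ler_wpM2r ?sqr_ge0//.
by rewrite -natrX ler_nat; apply: leq_trans (leqnSn d) _; rewrite expnS expn1 leq_pmulr.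
Qed.

End EuclideanNorm.

Section CompactDomain.
Variables (R : realType) (d : nat) (K : set 'rV[R]_d).
Hypothesis cK : compact K.

Local Notation dist := (fun x y : 'rV[R]_d => enorm (x - y)).

Lemma UC_within f : UC K dist f -> forall x eps, K x -> 0 < eps ->
  exists2 r, 0 < r & forall y, K y -> `|x - y| < r -> `|f x - f y| <= eps.
Proof.
move=> fu x eps Kx eps0; have [del del0 fd] := fu _ eps0.
exists (del / d.+1%:R); first by rewrite divr_gt0.
move=> y Ky; rewrite ltr_pdivlMr// mulrC => xy; apply: fd => //.
exact: le_trans (enorm_le_norm _) (ltW xy).
Qed.

Lemma CK_within f : CK K f -> forall x eps, K x -> 0 < eps ->
  exists2 r, 0 < r & forall y, K y -> `|x - y| < r -> `|f x - f y| <= eps.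
Proof.
move=> /subspace_continuousP fc x eps Kx eps0.
have /cvgrPdist_le /(_ eps eps0) := fc x Kx.
rewrite /within/= => /nbhs_ballP[r /= r0 rf]; exists r => // y Ky xy.
by apply: rf => //; rewrite -ball_normE.
Qed.

(** Common source of Heine's theorem, boundedness, Dini's theorem and the positive lower bound of
    the weights, all of which pass from local to uniform statements on [K]. *)
Lemma compact_uniform (I : Type) (F : set_system I) (P : I -> 'rV[R]_d -> Prop) :
  Filter F ->
  (forall x, K x -> exists2 r, 0 < r & \forall i \near F, forall y,
    K y -> `|x - y| < r -> P i y) ->
  \forall i \near F, forall x, K x -> P i x.
Proof.
move=> FF near_x.
have := (compact_near_coveringP K).1 cK I F (fun i y => K y -> P i y) FF.
have h : forall x, K x -> \forall x' \near x & i \near F, K x' -> P i x'.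
  move=> x Kx; have [r r0 rP] := near_x x Kx.
  exists (ball x r, [set i | forall y, K y -> `|x - y| < r -> P i y]) => /=.
    by split => //; exact: nbhsx_ballx.
  by move=> [y i] /= [xy Pi] Ky; apply: Pi => //; move: xy; rewrite -ball_normE.
by move=> /(_ h); apply: filterS => i Pi x Kx; exact: Pi.
Qed.

Lemma UC_CK f : UC K dist f -> CK K f.
Proof.
move=> fu; apply/subspace_continuousP => x Kx.
apply/cvgrPdist_le => eps eps0; have [r r0 rf] := UC_within fu Kx eps0.
rewrite /within /=; apply/nbhs_ballP; exists r => //= y.
by rewrite -ball_normE /= => xy Ky; exact: rf.
Qed.

Lemma CK_UC f : CK K f -> UC K dist f.
Proof.
move=> fc eps eps0; have e2 : 0 < eps / 2 by rewrite divr_gt0.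
have : \forall del \near (0:R)^'+, forall x, K x -> forall y, K y ->
    enorm (x - y) <= del -> `|f x - f y| <= eps.
  apply: compact_uniform => x Kx.
  have [r r0 rf] := CK_within fc Kx e2.
  exists (r / 2); first by rewrite divr_gt0.
  have r2 : 0 < r / 2 by rewrite divr_gt0.
  near=> del => x' Kx' xx' y Ky x'y.
  have del_lt : del < r / 2 by near: del; exact: nbhs_right_lt.
  have x'y2 : `|x' - y| < r / 2.
    exact: le_lt_trans (norm_le_enorm _) (le_lt_trans x'y del_lt).
  have h1 : `|f x - f x'| <= eps / 2.
    by apply: rf => //; apply: lt_le_trans xx' _; lra.
  have h2 : `|f x - f y| <= eps / 2.
    apply: rf => //; rewrite -(subrK x' x) -addrA.
    by apply: le_lt_trans (ler_normD _ _) _; lra.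
  move: h1 h2; rewrite !ler_norml => /andP[? ?] /andP[? ?]; lra.
move=> hd; near (0:R)^'+ => del.
exists del; first by near: del; exact: nbhs_right_gt.
have : forall x, K x -> forall y, K y ->
    enorm (x - y) <= del -> `|f x - f y| <= eps by near: del.
by move=> h x y Kx Ky; exact: h.
Unshelve. all: by end_near. Qed.

Lemma UC_bounded f : UC K dist f -> exists M, forall x, K x -> `|f x| <= M.
Proof.
move=> fu; have : \forall n \near \oo, forall x, K x -> `|f x| <= n%:R.
  apply: compact_uniform => x Kx; have [r r0 rf] := UC_within fu Kx ltr01.
  exists r => //; near=> n => y Ky xy.
  have : `|f x| + 1 <= n%:R.
    by near: n; exact: nbhs_infty_ger.
  have := rf y Ky xy; rewrite distrC => h1 h2.
  have := ler_normD (f y - f x) (f x); rewrite subrK; lra.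
by move=> /filter_ex[n fn]; exists n%:R.
Unshelve. all: by end_near. Qed.

Lemma CK_BUC f : CK K f <-> BUC K dist f.
Proof.
split=> [/CK_UC fu|[_ /UC_CK//]]; split => //; exact: UC_bounded.
Qed.

(** Monotonicity carries the bound found near a point at stage [n0] to all later stages, which makes
    it eventual. *)
Lemma dini_UC (g : nat -> 'rV[R]_d -> R) : (forall n, UC K dist (g n)) ->
  (forall n k x, (n <= k)%N -> K x -> g n x <= g k x) ->
  (forall x, K x -> exists n, 1 <= g n x) ->
  forall eps, 0 < eps -> exists n, forall x, K x -> 1 - eps <= g n x.
Proof.
move=> gu gm g1 eps eps0.
have : \forall n \near \oo, forall x, K x -> 1 - eps <= g n x.
  apply: compact_uniform => x Kx; have [n0 gn0] := g1 x Kx.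
  have [r r0 rg] := UC_within (gu n0) Kx eps0.
  exists r => //; exists n0 => // n /= n0n y Ky xy.
  apply: le_trans (gm _ _ _ n0n Ky).
  by have := rg y Ky xy; rewrite ler_norml => /andP[_]; lra.
by move=> /filter_ex[n gn]; exists n.
Qed.

Lemma closed_UC f c : UC K dist f -> closed (K `&` [set x | c <= f x]).
Proof.
move=> fu; have Kcl : closed K.
  by apply: compact_closed => //; exact: norm_hausdorff.
move=> x clx; have Kx : K x by apply: Kcl => U /clx[y [[Ky _] Uy]]; exists y.
split => //=; apply/ler_addgt0Pl => e e0.
have [r r0 rf] := UC_within fu Kx e0.
have [y [[Ky fy] xy]] := clx _ (nbhsx_ballx x r r0).
have := rf y Ky; move: xy; rewrite -ball_normE /= => xy /(_ xy).
by rewrite ler_norml => /andP[h1 h2]; move: fy => /=; lra.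
Qed.

End CompactDomain.

(** * The representing Borel measure and its uniqueness *)

Section RieszRepresentation.
Variables (R : realType) (d : nat) (K : set 'rV[R]_d) (x1 : 'rV[R]_d).
Hypothesis cK : compact K.
Hypothesis Kx1 : K x1.

Local Notation dist := (fun x y : 'rV[R]_d => enorm (x - y)).
Local Notation CC := (BUC K dist).
Local Notation borel := (borel_rV R d).

Lemma BUC_max0 f : CC f -> CC (fun x => Num.max (f x) 0).
Proof.
have max0 (s t : R) : `|Num.max s 0 - Num.max t 0| <= `|s - t|.
  have := lexx `|s - t|; rewrite {1}ler_norml => /andP[n1 n2].
  rewrite ler_norml !maxEle.
  by case: ifPn; rewrite -?ltNge => h1; case: ifPn; rewrite -?ltNge => h2; lra.
move=> [[M fM] fu]; split.
  exists M => x Kx; apply: le_trans (fM x Kx).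
  by have := max0 (f x) 0; rewrite maxxx !subr0.
move=> e /fu[del del0 fd]; exists del => // x y Kx Ky xy.
exact: le_trans (max0 _ _) (fd x y Kx Ky xy).
Qed.

Lemma borel_open (A : set borel) : open (A : set 'rV[R]_d) -> measurable A.
Proof. exact: sub_sigma_algebra. Qed.

Lemma borel_closed (A : set borel) : closed (A : set 'rV[R]_d) -> measurable A.
Proof.
move=> cA; rewrite -(setCK A); apply: measurableC; apply: borel_open.
exact: closed_openC.
Qed.

Lemma borel_compact : measurable (K : set borel).
Proof.
by apply: borel_closed; apply: (@compact_closed 'rV[R]_d).
Qed.

Lemma BUC_measurable f : CC f -> measurable_fun (K : set borel) f.
Proof.
move=> [_ fu] mK; apply: (measurability (@RGenCInfty.G R)).
  exact: RGenCInfty.measurableE.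
move=> _ [_ [c ->] <-]; apply: borel_closed.
have -> : K `&` f @^-1` `[c, +oo[%classic = K `&` [set x | c <= f x].
  by apply/seteqP; split => x [Kx] /=; rewrite in_itv/= andbT.
  exact: closed_UC.
exact: mK.
Qed.

(** Truncated multiples of the distance [D] to the complement of [U]. An empty complement is treated
    apart, because the infimum of the empty set would make [D] vanish. *)
Lemma open_exhaustion (U : set 'rV[R]_d) : open U -> exists phi : nat -> 'rV[R]_d -> R,
  [/\ forall k, CC (phi k),
      forall k x, K x -> 0 <= phi k x <= 1,
      forall n k x, (n <= k)%N -> K x -> phi n x <= phi k x,
      forall k x, K x -> ~ U x -> phi k x = 0 &
      forall x, K x -> U x -> exists k, phi k x = 1].
Proof.
move=> oU; have [C0|/set0P[y0 Cy0]] := eqVneq (~` U) set0.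
  exists (fun _ _ => 1); split.
  - by move=> k; exact: BUC_cst.
  - by move=> k x _; rewrite ler01 lexx.
  - by [].
  - by move=> k x _ nUx; have : (~` U) x by []; rewrite C0.
  - by move=> x _ _; exists 0%N.
pose D x := inf [set `|x - y| | y in ~` U].
have D_inf x : has_inf [set `|x - y| | y in ~` U].
  by split; [exists `|x - y0|, y0|exists 0 => _ [y _ <-]].
have D_ge0 x : 0 <= D x.
  by apply: lb_le_inf; [case: (D_inf x)|move=> _ [y _ <-]].
have D_lip x y : D x <= `|x - y| + D y.
  rewrite -lerBlDl; apply: lb_le_inf; first by case: (D_inf y).
  move=> _ [z Cz <-]; rewrite lerBlDl.
  apply: (@le_trans _ _ `|x - z|).
    by apply: ge_inf; [case: (D_inf x)|exists z].
  by rewrite -[x - z](subrKA y) ler_normD.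
exists (fun k x => Num.min 1 (k%:R * D x)); split.
- move=> k; split.
    exists 1 => x _; rewrite ger0_norm ?ge_min ?lexx//.
    by rewrite le_min ler01 mulr_ge0.
  move=> e e0; exists (e / k.+1%:R); first by rewrite divr_gt0.
  move=> x y _ _ /(le_trans (norm_le_enorm _)) xy.
  have min1 (s t r : R) : `|s - t| <= r -> `|Num.min 1 s - Num.min 1 t| <= r.
    rewrite !minEle ler_norml => /andP[h1 h2]; rewrite ler_norml.
    by case: ifPn; rewrite -?ltNge => h3; case: ifPn; rewrite -?ltNge => h4; lra.
  apply: min1; rewrite -mulrBr normrM ger0_norm//.
  have Dxy : `|D x - D y| <= e / k.+1%:R.
    apply: le_trans xy; rewrite ler_norml; have := D_lip x y; have := D_lip y x.
    by rewrite [`|y - x|]distrC; lra.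
  apply: (@le_trans _ _ (k.+1%:R * (e / k.+1%:R))).
    by apply: ler_pM => //; rewrite ler_nat.
  by rewrite mulrC divfK// gt_eqF.
- move=> k x _; rewrite ge_min lexx /= andbT le_min ler01 /=.
  by rewrite mulr_ge0.
- move=> n k x nk _; rewrite le_min ge_min lexx /=.
  by rewrite ge_min; apply/orP; right; rewrite ler_wpM2r// ler_nat.
- move=> k x _ nUx; have -> : D x = 0.
    apply/eqP; rewrite eq_le D_ge0 andbT; apply: ge_inf; first by case: (D_inf x).
    by exists x => //; rewrite subrr normr0.
  by rewrite mulr0 min_r.
- move=> x _ Ux; have /nbhs_ballP[r /= r0 rU] : nbhs x U by exact: open_nbhs_nbhs.
  have rD : r <= D x.
    apply: lb_le_inf; first by case: (D_inf x).
    move=> _ [z Cz <-]; rewrite leNgt; apply/negP => xz; apply: Cz.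
    by apply: rU; rewrite -ball_normE.
  exists (Num.bound r^-1); rewrite min_l//.
  have : r^-1 < (Num.bound r^-1)%:R by apply: archi_boundP; rewrite invr_ge0 ltW.
  move=> rb; apply: (@le_trans _ _ (r^-1 * r)); first by rewrite mulVf ?gt_eqF.
  by apply: ler_pM => //; rewrite ?invr_ge0 ltW.
Qed.

Variable Lam : ('rV[R]_d -> R) -> R.
Hypothesis Lam1 : Lam (fun=> 1) = 1.
Hypothesis LamD : forall f g, CC f -> CC g ->
  Lam (fun x => f x + g x) = Lam f + Lam g.
Hypothesis LamZ : forall c f, CC f -> Lam (fun x => c * f x) = c * Lam f.
Hypothesis Lam_ge0 : forall f, CC f -> (forall x, K x -> 0 <= f x) -> 0 <= Lam f.

Let CCD := @BUCD R 'rV[R]_d K dist.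
Let CCM := @BUCM R 'rV[R]_d K dist x1 Kx1.
Let CCZ c f (Cf : CC f) : CC (fun x => c * f x) := CCM (BUC_cst K dist c) Cf.

Let dini g : (forall n, CC (g n)) ->
  (forall n k x, (n <= k)%N -> K x -> g n x <= g k x) ->
  (forall x, K x -> exists n, 1 <= g n x) ->
  forall eps : R, 0 < eps -> exists n, forall x, K x -> 1 - eps <= g n x.
Proof. by move=> Cg; apply: dini_UC => // n; have [] := Cg n. Qed.

(** [Lam] acts on total functions; positivity on [K], used in both directions, makes it depend on
    the values on [K] alone. *)
Let eq_Lam f g : CC f -> CC g -> (forall x, K x -> f x = g x) -> Lam f = Lam g.
Proof.
move=> Cf Cg fg.
have le u v : CC u -> CC v -> (forall x, K x -> u x = v x) -> Lam v <= Lam u.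
  move=> Cu Cv uv; rewrite -subr_ge0 -mulN1r -LamZ// -LamD//; last exact: CCZ.
  apply: Lam_ge0; first by apply: CCD => //; exact: CCZ.
  by move=> x Kx; rewrite uv// mulN1r subrr.
by apply/eqP; rewrite eq_le !le// => x Kx; rewrite fg.
Qed.

Let mu0 : {outer_measure set 'rV[R]_d -> \bar R} :=
  riesz_outer (BUC_cst K dist) CCD Lam1 LamD LamZ Lam_ge0.

(** The Caratheodory sets form a sigma-algebra, so it is enough to treat open sets. *)
Let borel_caratheodory (A : set borel) : measurable A -> mu0.-caratheodory A.
Proof.
apply: (smallest_sub (C := sigma_algebra [set: 'rV[R]_d])).
  exact: (@sigma_algebra_measurable _ (caratheodory_type mu0)).
move=> U oU; have [phi [h1 h2 h3 h4 h5]] := open_exhaustion oU.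
exact: (emu_caratheodory (BUC_cst K dist) CCD CCM Lam1 LamD LamZ Lam_ge0
  h1 h2 h3 h4 h5).
Qed.

Definition riesz_fun : set borel -> \bar R := emu K CC Lam.

Let riesz_fun0 : riesz_fun set0 = 0%E.
Proof. exact: (outer_measure0 mu0). Qed.

Let riesz_fun_ge0 A : (0 <= riesz_fun A)%E.
Proof. exact: (outer_measure_ge0 mu0). Qed.

Let riesz_fun_sigma : semi_sigma_additive riesz_fun.
Proof.
move=> F mF tF mUF.
apply: (@caratheodory_measure_sigma_additive R 'rV[R]_d mu0 F) => //.
- by move=> i; exact: borel_caratheodory (mF i).
- exact: borel_caratheodory mUF.
Qed.

HB.instance Definition _ := isMeasure.Build _ borel R riesz_fun
  riesz_fun0 riesz_fun_ge0 riesz_fun_sigma.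

Let riesz_funT : riesz_fun setT = 1%E.
Proof.
by rewrite /riesz_fun /emu (rmuT (BUC_cst K dist) CCD CCM Lam1 LamD LamZ Lam_ge0 dini).
Qed.

HB.instance Definition _ :=
  Measure_isProbability.Build _ borel R riesz_fun riesz_funT.

Definition riesz_measure : probability borel R := riesz_fun.

Lemma riesz_measureK : riesz_measure K = 1%E.
Proof.
rewrite -riesz_funT /riesz_measure /riesz_fun /emu; congr (_%:E).
rewrite -(rmuI (BUC_cst K dist) Lam1 Lam_ge0 [set: 'rV[R]_d]).
by rewrite setTI.
Qed.

Lemma pairing_riesz f : CC f -> pairing K riesz_measure f = Lam f.
Proof.
apply: (@Rintegral_Lam _ _ borel riesz_measure K CC Lam) => //.
- exact: borel_compact.
- exact: riesz_measureK.
- exact: BUC_measurable.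
- by move=> g [].
- exact: BUC_cst.
- exact: BUC_max0.
move=> A g mA Cg g0 g1; rewrite lee_fin; apply: (rmu_le (BUC_cst K dist) Lam1 Lam_ge0).
exact: covered_const.
Qed.

(** For a cover [g] of [A] at cost [t], the sets [B n] where [g n] has reached 1 increase to the
    part of [A] in [K], and each has mass at most the integral of [g n], that is [Lam (g n)].
    Continuity from below then bounds the mass of [A] by [t]. *)
Lemma riesz_measure_ge (mu : probability borel R) :
  mu K = 1%E -> (forall f, CC f -> pairing K mu f = Lam f) ->
  forall A, measurable A -> (mu A <= riesz_measure A)%E.
Proof.
move=> muK muL A mA.
have mK := borel_compact.
have -> : mu A = mu (A `&` K).
  apply/eqP; rewrite eq_le; apply/andP; split; last first.
    by apply: le_measure; rewrite ?inE//; exact: measurableI.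
  rewrite -[X in (mu X <= _)%E](setUIDK A K).
  apply: le_trans (measureU2 _ _ _) _; [exact: measurableI|exact: measurableD|].
  rewrite -[leRHS]adde0; apply: leeD => //.
  apply: (@le_trans _ _ (mu (~` K))).
    apply: le_measure => [||x []//]; rewrite inE; first exact: measurableD.
    exact: measurableC.
  have := probability_setC mu mK; rewrite muK subee// => ->.
  exact: lexx.
rewrite -[mu _]fineK ?fin_num_measure//; last exact: measurableI.
rewrite lee_fin; apply: lb_le_inf.
  by exists 1; exact: (coveredT K (BUC_cst K dist) Lam1).
move=> t [g [Cg g0 gm gt g1]].
pose B n := A `&` (K `&` [set x | 1 <= g n x]).
have mB n : measurable (B n : set borel).
  apply: measurableI => //; apply: borel_closed; apply: closed_UC => //.
  by have [] := Cg n.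
have BE : \bigcup_n B n = A `&` K.
  apply/seteqP; split => [x [n _ [Ax [Kx _]]]//|x [Ax Kx]].
  by have [n gn] := g1 x Ax Kx; exists n.
have B_le n : (mu (B n) <= t%:E)%E.
  rewrite -[mu _]fineK ?fin_num_measure// lee_fin.
  apply: le_trans (gt n); rewrite -muL//.
  have intg : mu.-integrable K (EFin \o g n).
    have [M gM] := (Cg n).1; apply: (bounded_integrable _ borel_compact) gM.
    exact: BUC_measurable.
  have -> : fine (mu (B n)) = \int[mu]_(x in K) \1_(B n) x.
    rewrite /Rintegral integral_indic//; congr (fine (mu _)).
    by apply/seteqP; split => [x|x []//] [Ax [Kx gx]].
  apply: le_Rintegral => //.
    apply: (bounded_integrable _ borel_compact (M := 1)).
      exact: measurable_indic.
    by move=> x _; rewrite indicE; case: (_ \in _); rewrite ?normr1 ?normr0.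
  move=> x Kx; rewrite indicE; case: (boolP (x \in B n)); last by rewrite g0.
  by rewrite inE => -[_ []].
have ndB : nondecreasing_seq B.
  move=> n k nk; apply/subsetPset => x [Ax [Kx gx]]; split => //; split => //=.
  exact: le_trans gx (gm _ _ _ nk Kx).
have mU : measurable (\bigcup_n B n) by exact: bigcupT_measurable.
have cB : (mu \o B) @ \oo --> mu (\bigcup_n B n).
  exact: nondecreasing_cvg_mu.
rewrite -BE -lee_fin fineK ?fin_num_measure// -(cvg_lim _ cB)//.
by apply: lime_le; [exact: cvgP cB|exact: nearW].
Qed.

(** Both measures have total mass 1, so the inequality on the complement of [A] is the reverse
    inequality on [A]. *)
Lemma riesz_unique (mu : probability borel R) :
  mu K = 1%E -> (forall f, CC f -> pairing K mu f = Lam f) ->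
  forall A, measurable A -> mu A = riesz_measure A.
Proof.
move=> muK muL A mA; apply/eqP; rewrite eq_le riesz_measure_ge//=.
have := riesz_measure_ge muK muL (measurableC mA).
rewrite !probability_setC//.
have fA (P : probability borel R) : P A \is a fin_num by rewrite fin_num_measure.
rewrite -[mu A]fineK// -[riesz_measure A]fineK// -!EFinB !lee_fin.
by rewrite lerD2l lerN2.
Qed.

End RieszRepresentation.

(** * Dini continuity and weak contractions *)

Section DiniModulus.
Variables (R : realType) (d : nat) (X : set 'rV[R]_d) (p : 'rV[R]_d -> R).
Hypothesis X0 : X !=set0.

Let al (t : R) : \bar R := modulus X (fun x y => `|p x - p y|) t.

Lemma modulus_ge x y t : X x -> X y -> enorm (x - y) <= t ->
  ((`|p x - p y|)%:E <= al t)%E.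
Proof. by move=> Xx Xy xy; apply: ereal_sup_ubound; exists x, y. Qed.

Lemma le_modulus s t : s <= t -> (al s <= al t)%E.
Proof.
move=> st; apply: le_ereal_sup => _ [x [y [Xx Xy xy ->]]].
by exists x, y; split => //; exact: le_trans xy st.
Qed.

Lemma enorm0 : enorm (0 : 'rV[R]_d) = 0.
Proof. by rewrite /enorm big1 ?sqrtr0// => i _; rewrite mxE expr0n. Qed.

Lemma modulus_ge0 t : 0 <= t -> (0 <= al t)%E.
Proof.
move=> t0; have [x Xx] := X0; have := @modulus_ge x x t Xx Xx.
by rewrite !subrr normr0 enorm0; apply.
Qed.

(** The modulus is nondecreasing, so its superlevel sets are intervals. *)
Lemma measurable_modulus (D : set R) : measurable D -> measurable_fun D al.
Proof.
move=> mD; apply: (measurability (@ErealGenCInfty.G R)).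
  exact: ErealGenCInfty.measurableE.
move=> _ [_ [c ->] <-]; apply: measurableI => //.
apply: is_interval_measurable => s t /=; rewrite !in_itv/= !andbT => cs ct u.
by move=> /andP[su ut]; rewrite in_itv/= andbT; apply: le_trans cs (le_modulus su).
Qed.

Hypothesis dini : Dini_continuous X p.

(** Each shell between [th ^+ k.+1] and [th ^+ k] contributes to the Dini integral at least a fixed
    multiple of the modulus at its inner end, and the tails [J] telescope. The exponent [i.+1]
    matters: the integral gives no bound on the modulus at 1 itself. *)
Lemma dini_geometric_sum (th : R) : 0 < th -> th < 1 ->
  exists (e : nat -> R) (S : R),
  [/\ forall i, 0 <= e i, forall n, \sum_(i < n) e i <= S &
    forall i x y, X x -> X y -> enorm (x - y) <= th ^+ i.+1 ->
      `|p x - p y| <= e i].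
Proof.
move=> th0 th1; pose f t : \bar R := (al t * (t^-1)%:E)%E.
have thn n : 0 < th ^+ n by rewrite exprn_gt0.
have thS n : th ^+ n.+1 < th ^+ n by rewrite exprS gtr_pMl.
pose J (k : nat) : \bar R :=
  (\int[@lebesgue_measure R]_(t in `]0%R, (th ^+ k)%R]) f t)%E.
have f_ge0 s t : 0 <= s -> s < t -> (0 <= f t)%E.
  move=> s0 st; have t0 := le_lt_trans s0 st.
  by rewrite mule_ge0 ?modulus_ge0 ?lee_fin ?invr_ge0 ?(ltW t0).
have mf (D : set R) : measurable D -> D `<=` `]0%R, +oo[ -> measurable_fun D f.
  move=> mD D0; apply: emeasurable_funM; first exact: measurable_modulus.
  apply/measurable_EFinP; apply: (measurable_funS _ D0) => //.
  apply: open_continuous_measurable_fun; first exact: interval_open.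
  move=> x; rewrite inE/= in_itv/= andbT => x0; apply: inv_continuous.
  by rewrite gt_eqF.
(* On the shell the modulus is at least its value at the inner end and [t^-1] is at least the
   inverse of the outer end, while the length is [th ^+ k * (1 - th)]. *)
have piece k : (al (th ^+ k.+1)%R * (1 - th)%R%:E + J k.+1 <= J k)%E.
  have -> : J k = (J k.+1 +
      \int[@lebesgue_measure R]_(t in `](th ^+ k.+1)%R, (th ^+ k)%R]) f t)%E.
    rewrite /J -ge0_integral_setU//=; last 3 first.
    - apply: mf; first exact: measurableU.
      by move=> x /= [|]; rewrite !in_itv/= andbT => /andP[]// + _; apply: lt_trans.
    - move=> x /= [|]; rewrite in_itv/= => /andP[x0 _]; first exact: f_ge0 x0.
      by apply: f_ge0 x0; exact: ltW.
    - apply/disj_setPS => x [] /=; rewrite !in_itv/= => /andP[_ xk] /andP[xk' _].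
      by have := lt_le_trans xk' xk; rewrite ltxx.
    congr (integral _ _ _); apply/seteqP; split => x /=; rewrite !in_itv/=.
      move=> /andP[x0 xk]; have [h|h] := leP x (th ^+ k.+1)%R.
        by left; rewrite x0.
      by right; rewrite xk.
    case=> /andP[x0 xk]; first by rewrite x0 (le_trans xk (ltW (thS k))).
    by rewrite xk (lt_trans _ x0).
  rewrite addeC leeD2l//.
  have -> : (al (th ^+ k.+1)%R * (1 - th)%R%:E =
      \int[@lebesgue_measure R]_(t in `](th ^+ k.+1)%R, (th ^+ k)%R])
        (al (th ^+ k.+1)%R * ((th ^+ k)^-1)%R%:E))%E.
    rewrite integral_cst//= lebesgue_measure_itv/= lte_fin thS -EFinD.
    rewrite -muleA -EFinM; congr (_ * _%:E)%E.
    by rewrite exprS mulrBr mulVf ?gt_eqF// mulrCA mulVf ?gt_eqF// mulr1.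
  apply: ge0_le_integral => //=.
  - by move=> x _; rewrite mule_ge0 ?modulus_ge0 ?lee_fin ?invr_ge0 ?(ltW (thn _)).
  - apply: mf => // x /=; rewrite !in_itv/= andbT => /andP[xk _].
    exact: lt_trans xk.
  move=> x /=; rewrite in_itv/= => /andP[xk xk'].
  have x0 : 0 < x by exact: lt_trans xk.
  apply: lee_pmul; [exact/modulus_ge0/ltW| | |].
  - by rewrite lee_fin invr_ge0 ltW.
  - exact/le_modulus/ltW.
  - by rewrite lee_fin lef_pV2 ?posrE.
have J_ge0 k : (0 <= J k)%E.
  by apply: integral_ge0 => x /=; rewrite in_itv/= => /andP[x0 _]; exact: f_ge0 x0.
have th1' : 0 < 1 - th by rewrite subr_gt0.
have al_ge0 k : (0 <= al (th ^+ k.+1)%R)%E by exact/modulus_ge0/ltW.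
have alth_ge0 k : (0 <= al (th ^+ k.+1)%R * (1 - th)%R%:E)%E.
  by rewrite mule_ge0// lee_fin ltW.
have J_fin k : (J k < +oo)%E.
  elim: k => [|k IH]; first by rewrite /J expr0.
  by apply: le_lt_trans IH; apply: le_trans (piece k); rewrite leeDr.
have al_fin k : al (th ^+ k.+1)%R \is a fin_num.
  rewrite ge0_fin_numE// ltey; apply/eqP => aloo.
  have : (al (th ^+ k.+1)%R * (1 - th)%R%:E <= J k)%E.
    by apply: le_trans (piece k); rewrite leeDl.
  by rewrite aloo gt0_mulye ?lte_fin// leNgt J_fin.
have Jr k : J k \is a fin_num by rewrite ge0_fin_numE.
exists (fun k => fine (al (th ^+ k.+1)%R)), (fine (J 0%N) / (1 - th)); split.
- by move=> k; rewrite fine_ge0.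
- move=> n; rewrite ler_pdivlMr// mulr_suml.
  suff : \sum_(k < n) fine (al (th ^+ k.+1)%R) * (1 - th) + fine (J n) <= fine (J 0%N).
    by have : 0 <= fine (J n) by [rewrite fine_ge0]; lra.
  elim: n => [|n IH]; first by rewrite big_ord0 add0r.
  apply: le_trans IH; rewrite big_ord_recr /= -addrA lerD2l.
  by rewrite -lee_fin EFinD EFinM !fineK.
move=> i x y Xx Xy xy; rewrite -lee_fin fineK//; exact: modulus_ge.
Qed.

End DiniModulus.

Lemma compact_enorm_bounded (R : realType) (d : nat) (K : set 'rV[R]_d) :
  compact K -> exists2 M : R, 0 < M & forall x y, K x -> K y -> enorm (x - y) <= M.
Proof.
move=> cK; have [M [_ KM]] := compact_bounded cK.
have M1 : M < `|M| + 1 by have := ler_norm M; lra.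
exists (d.+1%:R * (2 * (`|M| + 1))) => [|x y Kx Ky].
  by rewrite !mulr_gt0// ltr_wpDl.
apply: le_trans (enorm_le_norm _) _; apply: ler_wpM2l => //.
apply: le_trans (ler_normB _ _) _.
by have := KM _ M1 x Kx; have := KM _ M1 y Ky => /=; lra.
Qed.

(** * Iterates of a weak contraction shrink the compact set *)

Section WeakContraction.
Variables (R : realType) (d : nat) (X K : set 'rV[R]_d) (w : 'rV[R]_d -> 'rV[R]_d).

Lemma enorm_continuous : continuous (@enorm R d).
Proof.
suff cs r : continuous (fun x : 'rV[R]_d => \sum_(i <- r) x ord0 i ^+ 2).
  by move=> x; apply: (continuous_comp (cs _ x)); exact: sqrt_continuous.
elim: r => [|i r IH] x.
  have -> : (fun x : 'rV[R]_d => \sum_(i <- [::]) x ord0 i ^+ 2) = (fun=> 0).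
    by apply/funext => y; rewrite big_nil.
  exact: cst_continuous.
have -> : (fun x : 'rV[R]_d => \sum_(j <- i :: r) x ord0 j ^+ 2) =
    (fun x => x ord0 i * x ord0 i + \sum_(j <- r) x ord0 j ^+ 2).
  by apply/funext => y; rewrite big_cons expr2.
have ci : {for x, continuous (fun y : 'rV[R]_d => y ord0 i)}.
  exact: coord_continuous.
exact: (continuousD (continuousM ci ci) (IH x)).
Qed.

Lemma enorm_near (v : 'rV[R]_d) eps : 0 < eps ->
  exists2 r, 0 < r & forall v', `|v - v'| < r -> `|enorm v - enorm v'| <= eps.
Proof.
move=> eps0; have /cvgrPdist_le /(_ eps eps0) : @enorm R d v' @[v' --> v] --> enorm v.
  exact: enorm_continuous.
move=> /nbhs_ballP[r /= r0 rv]; exists r => // v' vv'.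
by apply: rv; rewrite -ball_normE.
Qed.

Lemma enorm_gt0 (x y : 'rV[R]_d) : x != y -> 0 < enorm (x - y).
Proof.
move=> xy; apply: lt_le_trans (norm_le_enorm _).
by rewrite normr_gt0 subr_eq0.
Qed.

Hypothesis KX : K `<=` X.
Hypothesis cK : compact K.
Hypothesis wK : forall x, K x -> K (w x).
Hypothesis w_nonexp : nonexpansive X w.
Hypothesis w_weak : weakly_contractive X w.

Let w_lt x y : K x -> K y -> x != y -> enorm (w x - w y) < enorm (x - y).
Proof.
move=> Kx Ky /enorm_gt0 xy; rewrite -lte_fin; apply: le_lt_trans (w_weak xy).
by apply: ereal_sup_ubound; exists x, y; split => //; exact: KX.
Qed.

(* Compactness of K x K turns strict contraction into a uniform decrease of the
   distances bounded away from 0. *)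
Lemma uniform_decrease del : 0 < del -> exists2 c, 0 < c &
  forall x y, K x -> K y -> del <= enorm (x - y) ->
    enorm (w x - w y) <= enorm (x - y) - c.
Proof.
move=> del0.
have cKK : compact (K `*` K) by exact: compact_setX.
pose P (c : R) (z : 'rV[R]_d * 'rV[R]_d) := K z.1 -> K z.2 ->
  del <= enorm (z.1 - z.2) -> enorm (w z.1 - w z.2) <= enorm (z.1 - z.2) - c.
have h : forall z, (K `*` K) z ->
    \forall z' \near z & c \near (0 : R)^'+, P c z'.
  move=> [x y] [/= Kx Ky].
  (* Near a diagonal point the pairs are closer than [del] and [P] holds vacuously. Elsewhere the
     strict gap is [3 * g]; each of the two distances varies by at most [g], which leaves a decrease
     of [g]. *)
  have key : exists2 r, 0 < r & exists2 g, 0 < g & forall c x' y', c <= g ->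
      `|x - x'| < r -> `|y - y'| < r -> P c (x', y').
    have [xy|xy] := eqVneq x y.
      have [r r0 rP] := enorm_near 0 (divr_gt0 del0 (ltr0n R 2)).
      exists (r / 2); first by rewrite divr_gt0.
      exists 1 => // c x' y' _ xx' yy' _ _ /=.
      have : `|0 - (x' - y')| < r.
        rewrite sub0r opprB -(subrKA x) xy [`|y - y'|]distrC in yy' *.
        apply: le_lt_trans (ler_normD _ _) _.
        by move: xx' yy'; rewrite xy; lra.
      by move=> /rP; rewrite enorm0 sub0r normrN ger0_norm ?enorm_ge0//; lra.
    have gap := w_lt Kx Ky xy.
    pose g := (enorm (x - y) - enorm (w x - w y)) / 3.
    have gE : enorm (x - y) - enorm (w x - w y) = 3 * g by rewrite /g; field.
    have g0 : 0 < g by lra.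
    have [r1 r10 r1P] := enorm_near (x - y) g0.
    have [r2 r20 r2P] := enorm_near (w x - w y) g0.
    have d1 : 0 < d.+1%:R :> R by [].
    pose r := Num.min (r1 / 2) (r2 / 2 / d.+1%:R).
    exists r; first by rewrite lt_min !divr_gt0.
    exists g => // c x' y' cg xx' yy' Kx' Ky' _ /=.
    have sub_lt (a b a' b' : 'rV[R]_d) s : `|a - a'| < s / 2 -> `|b - b'| < s / 2 ->
        `|(a - b) - (a' - b')| < s.
      move=> h1 h2; rewrite opprD addrACA -opprD.
      by apply: le_lt_trans (ler_normB _ _) _; lra.
    have w_near (a a' : 'rV[R]_d) : K a -> K a' -> `|a - a'| < r ->
        `|w a - w a'| < r2 / 2.
      move=> Ka Ka'; rewrite lt_min => /andP[_]; rewrite ltr_pdivlMr// mulrC => hr.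
      apply: le_lt_trans hr; apply: le_trans (enorm_le_norm _).
      apply: le_trans (norm_le_enorm _) _.
      by apply: w_nonexp; exact: KX.
    have h1 : `|enorm (x - y) - enorm (x' - y')| <= g.
      by apply/r1P/sub_lt; [move: xx'|move: yy']; rewrite lt_min => /andP[].
    have h2 : `|enorm (w x - w y) - enorm (w x' - w y')| <= g.
      by apply/r2P/sub_lt; exact: w_near.
    move: h1 h2; rewrite !ler_norml => /andP[? ?] /andP[? ?].
    by move: cg gE; lra.
  have [r r0 [g g0 gP]] := key.
  exists (ball x r `*` ball y r, [set c | c <= g]) => /=.
    split; last by near=> c; exact/ltW.
    by exists (ball x r, ball y r) => //=; split; exact: nbhsx_ballx.
  move=> [[x' y'] c] /= [[xx' yy'] cg]; apply: gP => //.
    by move: xx'; rewrite -ball_normE.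
  by move: yy'; rewrite -ball_normE.
have := (compact_near_coveringP _).1 cKK _ _ P _ h => /(_ _) hc.
near (0 : R)^'+ => c; exists c; first by near: c; exact: nbhs_right_gt.
have : K `*` K `<=` P c by near: c.
by move=> Pc x y Kx Ky; exact: (Pc (x, y)).
Unshelve. all: by end_near. Qed.

(** The distance drops by [c] at each step as long as it exceeds [del]; afterwards nonexpansiveness
    keeps it there. *)
Lemma iter_contraction del : 0 < del -> exists N, forall x y, K x -> K y ->
  enorm (iter N w x - iter N w y) <= del.
Proof.
move=> del0; have [c c0 wc] := uniform_decrease del0.
have [M _ KM] := compact_enorm_bounded cK.
have iK n x : K x -> K (iter n w x) by move=> Kx; elim: n => //= n; exact: wK.
have dec n x y : K x -> K y ->
    enorm (iter n w x - iter n w y) <= Num.max del (M - n%:R * c).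
  move=> Kx Ky; elim: n => [|n IH].
    by rewrite le_max; apply/orP; right; rewrite mul0r subr0 KM.
  have [small|big] := leP (enorm (iter n w x - iter n w y)) del.
    rewrite le_max; apply/orP; left; apply: le_trans small.
    by apply: w_nonexp; exact/KX/iK.
  have := wc _ _ (iK n x Kx) (iK n y Ky) (ltW big).
  move: IH; rewrite !le_max leNgt big /= => h1 h2.
  by apply/orP; right; rewrite -natr1; lra.
exists (Num.bound (`|M| / c)) => x y Kx Ky; apply: le_trans (dec _ x y Kx Ky) _.
rewrite ge_max lexx /=.
have : `|M| / c < (Num.bound (`|M| / c))%:R.
  by apply: archi_boundP; rewrite divr_ge0 // ltW.
by rewrite ltr_pdivrMr//; have := ler_norm M; lra.
Qed.

End WeakContraction.

(** * Uniform bounds and moduli for the family of weights *)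

Section DiniSystem.
Variables (R : realType) (d m : nat) (X K : set 'rV[R]_d).
Variable p : 'I_m -> 'rV[R]_d -> R.
Hypothesis X0 : X !=set0.
Hypothesis KX : K `<=` X.
Hypothesis cK : compact K.
Hypothesis p_dini : forall j, Dini_continuous X (p j).

Local Notation dist := (fun x y : 'rV[R]_d => enorm (x - y)).

(** Continuity of the weights follows from the Dini condition: summable moduli become arbitrarily
    small. The ratio [2^-1] is an arbitrary choice in []0, 1[]. *)
Lemma Dini_UC j : UC K dist (p j).
Proof.
move=> eps eps0; have h0 : 0 < 2^-1 :> R by [].
have h1 : 2^-1 < 1 :> R by lra.
have [e [S [e0 eS pe]]] := dini_geometric_sum X0 (p_dini j) h0 h1.
have [i e_tail] := tail_sum_small e0 eS eps0.
exists (2^-1 ^+ i.+1); first exact: exprn_gt0.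
move=> x y Kx Ky xy; apply: le_trans (pe i x y (KX Kx) (KX Ky) xy) _.
by have := e_tail 1%N; rewrite big_ord1 addn0.
Qed.

Lemma bounded_family : exists2 B : R, 0 <= B & forall j x, K x -> `|p j x| <= B.
Proof.
have hj j : exists M : R, forall x, K x -> `|p j x| <= M.
  exact: (UC_bounded cK (@Dini_UC j)).
have [M pM] := choice hj.
exists (\sum_j `|M j|); first by apply: sumr_ge0.
move=> j x Kx; apply: le_trans (pM j x Kx) _.
apply: le_trans (ler_norm _) _; rewrite (bigD1 j)//= lerDl.
by apply: sumr_ge0.
Qed.

Lemma bounded_below_family : (forall j x, K x -> 0 < p j x) ->
  exists2 c, 0 < c & forall j x, K x -> c <= p j x.
Proof.
move=> p0; have : \forall n \near \oo, forall j x, K x -> n.+1%:R^-1 <= p j x.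
  apply: filter_forall => j; apply: (compact_uniform cK) => x Kx.
  have p2 : 0 < p j x / 2 by rewrite divr_gt0// p0.
  have [r r0 rp] := UC_within (@Dini_UC j) Kx p2.
  exists r => //; near=> n => y Ky xy.
  have : n.+1%:R^-1 <= p j x / 2.
    rewrite invf_ple ?posrE//; near: n.
    exists (Num.bound (p j x / 2)^-1) => // n /= nb.
    have : (p j x / 2)^-1 < (Num.bound (p j x / 2)^-1)%:R.
      by apply: archi_boundP; rewrite invr_ge0 ltW.
    move=> /ltW/le_trans; apply; rewrite ler_nat; exact: leqW.
  move=> h; apply: le_trans h _.
  by have := rp y Ky xy; rewrite ler_norml => /andP[_]; lra.
by move=> /filter_ex[n pn]; exists n.+1%:R^-1.
Unshelve. all: by end_near. Qed.

Lemma dini_scales (th : R) : 0 < th -> th < 1 -> forall s, 0 < s ->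
  exists (e : nat -> R) (S : R),
  [/\ forall i, 0 <= e i, forall n, \sum_(i < n) e i <= S &
    forall i j x y, K x -> K y -> enorm (x - y) <= s * th ^+ i ->
      `|p j x - p j y| <= e i].
Proof.
move=> th0 th1 s s0.
have [B B0 pB] := bounded_family.
have hj j : exists eS : (nat -> R) * R,
    [/\ forall i, 0 <= eS.1 i, forall n, \sum_(i < n) eS.1 i <= eS.2 &
    forall i x y, X x -> X y -> enorm (x - y) <= th ^+ i.+1 ->
      `|p j x - p j y| <= eS.1 i].
  have [e [S h]] := dini_geometric_sum X0 (p_dini j) th0 th1.
  by exists (e, S).
have [F FP] := choice hj.
have F0 j i : 0 <= (F j).1 i by have [h _ _] := FP j; exact: h.
pose E k := \sum_j (F j).1 k.
have E0 k : 0 <= E k by apply: sumr_ge0.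
have [N thN] := expr_small (ltW th0) th1 (divr_gt0 ltr01 s0).
(* Since [s * th ^+ N] is at most 1, a distance below [s * th ^+ i] with [i] beyond [N] is below
   [th] to the power [(i - N.+1).+1], which the sums [E] control. The finitely many earlier scales
   use the crude bound [2 * B]. *)
pose e i := if (i < N.+1)%N then 2 * B else E (i - N.+1)%N.
have e_ge0 i : 0 <= e i by rewrite /e; case: ifP => // _; rewrite mulr_ge0.
exists e, (N.+1%:R * (2 * B) + \sum_j (F j).2); split => //.
  move=> n; apply: (@le_trans _ _ (\sum_(i < N.+1 + n) e i)).
    by rewrite addnC big_split_ord /= lerDl; apply: sumr_ge0.
  rewrite big_split_ord /=; apply: lerD.
    rewrite mulr_natl -[X in _ *+ X]card_ord -sumr_const.
    by apply: ler_sum => i _; rewrite /e ltn_ord.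
  rewrite (eq_bigr (fun i : 'I_n => E i)); last first.
    by move=> i _; rewrite /e ltnNge leq_addr /= addKn.
  rewrite exchange_big /=; apply: ler_sum => j _.
  by have [_ h _] := FP j; exact: h.
move=> i j x y Kx Ky xy; rewrite /e; case: ifPn => [_|].
  apply: le_trans (ler_normB _ _) _.
  by have := pB j x Kx; have := pB j y Ky; lra.
rewrite -leqNgt => Ni; apply: (@le_trans _ _ ((F j).1 (i - N.+1)%N)).
  have [_ _ h] := FP j; apply: h; [exact: KX|exact: KX|].
  apply: le_trans xy _; rewrite -{1}(subnKC Ni) addSnnS exprD mulrA ler_piMl//.
    by rewrite exprn_ge0// ltW.
  by rewrite mulrC -ler_pdivlMr.
by rewrite /E (bigD1 j)//= lerDl; apply: sumr_ge0.
Qed.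

End DiniSystem.

(** Nonexpansiveness bounds the quotients by 1, so [sup] is a true least upper bound; when [x] is
    the only point of [K], it is [sup set0 = 0]. *)
Lemma lip_at_bounds (R : realType) (d : nat) (K : set 'rV[R]_d) w x :
  nonexpansive K w -> K x ->
  [/\ 0 <= lip_at K w x, lip_at K w x <= 1 &
    forall y, K y -> enorm (w x - w y) <= lip_at K w x * enorm (x - y)].
Proof.
move=> w_ne Kx.
set P := [set enorm (w x - w y) / enorm (x - y) | y in K `\ x].
have P01 z : P z -> 0 <= z <= 1.
  move=> [y [Ky /eqP yx] <-]; have xy : 0 < enorm (x - y).
    by apply: enorm_gt0; rewrite eq_sym.
  rewrite divr_ge0 ?enorm_ge0//= ler_pdivrMr// mul1r; exact: w_ne.
have P_ub : has_ubound P by exists 1 => z /P01/andP[].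
rewrite /lip_at -/P; split.
- have [->|/set0P[z Pz]] := eqVneq P set0; first by rewrite sup0.
  by have /andP[z0 _] := P01 z Pz; apply: le_trans z0 _; exact: ub_le_sup.
- have [->|/set0P P0] := eqVneq P set0; first by rewrite sup0.
  by apply: ge_sup => // z /P01/andP[].
move=> y Ky; have [<-|xy] := eqVneq x y.
  by rewrite !subrr enorm0 mulr0.
have exy := enorm_gt0 xy; rewrite -ler_pdivrMr//; apply: ub_le_sup => //.
by exists y => //; split => //; apply/eqP; rewrite eq_sym.
Qed.

(** * The theorem *)

(** The eigenfunction [h] makes [rh - T] non-injective, so [rh] itself is in the spectrum, and
    nothing of larger modulus is. *)
Lemma spectral_radiusE (R : realType) (d m : nat) (K : set 'rV[R]_d)
    (w : 'I_m -> 'rV[R]_d -> 'rV[R]_d) (p : 'I_m -> 'rV[R]_d -> R)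
    (rh : R) (h : 'rV[R]_d -> R) (x1 : 'rV[R]_d) :
  K x1 -> 0 < rh -> CK K h -> 0 < h x1 ->
  (forall x, K x -> ruelle w p h x = rh * h x) ->
  (forall l : R[i], rh < Normc.normc l -> resolvent_set K (ruelle w p) l) ->
  spectral_radius K (ruelle w p) = rh.
Proof.
move=> Kx1 rh0 Ch h0 Th res; pose S := [set Normc.normc l | l in
  ~` resolvent_set K (ruelle w p)].
have S_ub : ubound S rh.
  by move=> _ [l nl <-]; rewrite leNgt; apply/negP => /res.
have C0 : CK K (fun=> 0) by move=> x; exact: cvg_cst.
have T0 x : ruelle w p (fun=> 0) x = 0.
  by rewrite /ruelle big1// => j _; rewrite mulr0.
have S_rh : S rh.
  exists (rh%:C)%C; last by rewrite /= expr0n addr0 sqrtr_sqr gtr0_norm.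
  move=> rhres; have [_ uniq] := rhres (fun=> 0) (conj C0 C0).
  have := uniq (fun x => (h x)%:C)%C (fun=> 0) (conj Ch C0) (conj C0 C0).
  have e1 : {in K, forall x, (rh%:C)%C * ((h x)%:C)%C -
      complexify (ruelle w p) (fun x => (h x)%:C)%C x = 0}.
    move=> x; rewrite inE => Kx; rewrite /complexify /= T0 Th//.
    by apply/eqP; rewrite eq_complex /= !(mulr0, mul0r, addr0, subr0, subrr) eqxx.
  have e2 : {in K, forall x, (rh%:C)%C * 0 -
      complexify (ruelle w p) (fun=> 0) x = 0}.
    by move=> x _; rewrite /complexify /= T0 mulr0 subr0.
  move=> /(_ e1 e2 x1); rewrite inE => /(_ Kx1) => -[] h1.
  by move: h0; rewrite h1 ltxx.
apply/eqP; rewrite eq_le; apply/andP; split.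
  by apply: ge_sup => //; exists rh.
by apply: ub_le_sup => //; exists rh.
Qed.

Lemma supnorm_cvg0 (R : realType) (d : nat) (K : set 'rV[R]_d) (x1 : 'rV[R]_d)
    (F : nat -> 'rV[R]_d -> R) : K x1 ->
  (forall eta, 0 < eta -> exists N, forall n x, (N <= n)%N -> K x ->
    `|F n x| <= eta) ->
  supnorm K (F n) @[n --> \oo] --> (0 : R).
Proof.
move=> Kx1 FN; apply/cvgrPdist_le => eta eta0; have [N hN] := FN _ eta0.
exists N => // n /= Nn; rewrite sub0r normrN.
have ub : ubound [set `|F n x| | x in K] eta.
  by move=> _ [x Kx <-]; exact: hN.
rewrite ger0_norm; first by apply: ge_sup => //; exists `|F n x1|, x1.
apply: le_trans (normr_ge0 (F n x1)) _.
by apply: ub_le_sup; [exists eta|exists x1].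
Qed.

(** Boundedness of each [F n] guarantees that [supnorm] dominates the values: [sup] of an unbounded
    set is a default value. *)
Lemma supnorm_cvg0_pointwise (R : realType) (d : nat) (K : set 'rV[R]_d)
    (F : nat -> 'rV[R]_d -> R) :
  (forall n, exists M, forall x, K x -> `|F n x| <= M) ->
  supnorm K (F n) @[n --> \oo] --> (0 : R) ->
  forall x, K x -> forall eta, 0 < eta ->
    exists N, forall n, (N <= n)%N -> `|F n x| <= eta.
Proof.
move=> Fb /cvgrPdist_le F0 x Kx eta eta0.
have [N _ hN] := F0 _ eta0; exists N => n Nn; have := hN n Nn.
rewrite sub0r normrN => /(le_trans (ler_norm _)); apply: le_trans.
apply: ub_le_sup; last by exists x.
by have [M FM] := Fb n; exists M => _ [y Ky <-]; exact: FM.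
Qed.

Lemma eventually_close_unique (R : realType) (u : nat -> R) (s t : R) :
  (forall eta, 0 < eta -> exists N, forall n, (N <= n)%N -> `|u n - s| <= eta) ->
  (forall eta, 0 < eta -> exists N, forall n, (N <= n)%N -> `|u n - t| <= eta) ->
  s = t.
Proof.
move=> us ut; apply/eqP; rewrite -subr_eq0 -normr_le0.
apply/ler_addgt0Pl => e e0; rewrite addr0.
have e2 : 0 < e / 2 by rewrite divr_gt0.
have [N1 h1] := us _ e2; have [N2 h2] := ut _ e2.
have := h1 _ (leq_maxl N1 N2); have := h2 _ (leq_maxr N1 N2).
by rewrite !ler_norml => /andP[? ?] /andP[? ?]; lra.
Qed.

(* The minimum over the compact set K is written as an infimum. *)
Theorem corollary1p3 (R : realType) (d m : nat) (X : set 'rV[R]_d)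
    (w : 'I_m -> 'rV[R]_d -> 'rV[R]_d) (p : 'I_m -> 'rV[R]_d -> R)
    (K : set 'rV[R]_d) :
  nonexpansive_system X w p ->
  (exists j, weakly_contractive X (w j)) ->
  invariant_set X w K ->
  sup [set \sum_(j < m) p j x * lip_at K (w j) x | x in K] <
    inf [set \sum_(j < m) p j x | x in K] ->
  ruelle_operator_theorem K w p.
Proof.
move=> [X0 cX wX w_ne p_dini] [j0 w_weak] [[K0 cK KX KE] _] ab.
have [x1 Kx1] := K0.
pose dist := fun x y : 'rV[R]_d => enorm (x - y).
have wK j x : K x -> K (w j x).
  by move=> Kx; rewrite KE; exists j => //; exists x.
have p_gt0 j x : K x -> 0 < p j x by move=> /KX; have [h _] := p_dini j; exact: h.
have p_D j : Dini_continuous X (p j) by have [] := p_dini j.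
have [B B0 p_norm] := bounded_family X0 KX cK p_D.
have p_le j x : K x -> p j x <= B.
  by move=> Kx; exact: le_trans (ler_norm _) (p_norm j x Kx).
have [c0 c0_gt0 p_ge] := bounded_below_family X0 KX cK p_D p_gt0.
have p_ge0 j x : K x -> 0 <= p j x by move=> Kx; exact/ltW/p_gt0.
have [D D_gt0 dist_le] := compact_enorm_bounded cK.
have w_nonexp j x y : K x -> K y -> dist (w j x) (w j y) <= dist x y.
  by move=> Kx Ky; apply: w_ne; exact: KX.
have w_contr : forall del, 0 < del -> exists N, forall x y, K x -> K y ->
    dist (iter N (w j0) x) (iter N (w j0) y) <= del.
  exact: (iter_contraction KX cK (wK j0) (w_ne j0) w_weak).
pose L j x := lip_at K (w j) x.
have Lb j x : K x -> [/\ 0 <= L j x, L j x <= 1 &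
    forall y, K y -> enorm (w j x - w j y) <= L j x * enorm (x - y)].
  by move=> Kx; apply: lip_at_bounds => // y z Ky Kz; exact: w_nonexp.
have w_lip j x y : K x -> K y -> dist (w j x) (w j y) <= L j x * dist x y.
  by move=> Kx; have [_ _ h] := Lb j x Kx; exact: h.
set a := sup _ in ab; set b := inf _ in ab.
have le_a x : K x -> \sum_(j < m) p j x * L j x <= a.
  move=> Kx; apply: ub_le_sup; last by exists x.
  exists (\sum_(j < m) B * 1) => _ [y Ky <-]; apply: ler_sum => j _.
  have [l0 l1 _] := Lb j y Ky.
  by apply: ler_pM => //; [exact: p_ge0|exact: p_le].
have b_le x : K x -> b <= \sum_(j < m) p j x.
  move=> Kx; apply: ge_inf; last by exists x.
  by exists 0 => _ [y Ky <-]; apply: sumr_ge0 => j _; exact: p_ge0.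
have a_ge0 : 0 <= a.
  apply: le_trans (le_a x1 Kx1); apply: sumr_ge0 => j _.
  by have [l0 _ _] := Lb j x1 Kx1; rewrite mulr_ge0 ?p_ge0.
have b_gt0 : 0 < b by exact: le_lt_trans ab.
(* The midpoint of [a / b] and 1 satisfies both [th < 1] and [a < b * th]. *)
pose th := (a / b + 1) / 2.
have ab1 : a / b < 1 by rewrite ltr_pdivrMr// mul1r.
have ab0 : 0 <= a / b by rewrite divr_ge0// ltW.
have th_gt0 : 0 < th by rewrite /th; lra.
have th_lt1 : th < 1 by rewrite /th; lra.
have a_lt : a < b * th by rewrite mulrC -ltr_pdivrMr// /th; lra.
have scales := dini_scales X0 KX cK p_D th_gt0 th_lt1.
have [rh [la [h [[rh_gt0 Bh h_gt0 Th lah] [[la1 laD laZ la0 laT] [cvg res]]]]]] :=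
  ruelle_core (fun x y => enorm_ge0 (x - y)) dist_le D_gt0 Kx1 wK w_nonexp w_lip
    c0_gt0 p_ge p_le a_ge0 th_gt0 a_lt le_a b_le scales w_contr.
have srE : spectral_radius K (ruelle w p) = rh.
  apply: (spectral_radiusE Kx1 rh_gt0 _ (h_gt0 _ Kx1) Th).
    exact/(CK_BUC cK).
  move=> l /res hl g [gR gI].
  have Bg : BUCC K dist g by split; exact/(CK_BUC cK).
  have [[f [fR fI] fE] uniq] := hl g Bg; split.
    exists f; first by split; exact/(CK_BUC cK).
    by move=> x; rewrite inE; exact: fE.
  move=> f1 f2 [f1R f1I] [f2R f2I] e1 e2 x; rewrite inE => Kx.
  apply: uniq => //.
  - by split; exact/(CK_BUC cK).
  - by split; exact/(CK_BUC cK).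
  - by move=> y Ky; apply: e1; rewrite inE.
  - by move=> y Ky; apply: e2; rewrite inE.
pose mu := riesz_measure cK Kx1 la1 laD laZ la0.
have muE f : CK K f -> pairing K mu f = la f.
  by move=> /(CK_BUC cK); exact: pairing_riesz.
have BT n f : CK K f -> BUC K dist (iter n (ruelle w p) f).
  move=> /(CK_BUC cK) Bf; elim: n => // n IH.
  by have [] := laT _ IH.
exists h, mu; split.
  rewrite /ruelle_pair srE; split; [|split; [|split; [|split; [|split]]]].
  - by split; [exact/(CK_BUC cK)|].
  - exact: riesz_measureK.
  - by move=> x; rewrite inE; exact: Th.
  - move=> f Cf; rewrite !muE//; first by have [] := laT f ((CK_BUC cK f).1 Cf).
    exact/(CK_BUC cK)/(BT 1%N).
  - by rewrite muE//; exact/(CK_BUC cK).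
  move=> f Cf; apply: (supnorm_cvg0 Kx1) => eta eta0.
  have [N hN] := cvg f ((CK_BUC cK f).1 Cf) eta eta0.
  by exists N => n x Nn Kx; rewrite muE//; exact: hN.
move=> h' mu' [[Ch' h'_gt0] [muK' [_ [_ [_ cvg']]]]].
rewrite srE in cvg'.
(* Both sides are limits of the same sequence [rh ^- n * T^n f x], the spectral radius having been
   identified with [rh]. *)
have lim f x : CK K f -> K x -> pairing K mu' f * h' x = la f * h x.
  move=> Cf Kx; apply: (@eventually_close_unique _
    (fun n => rh ^- n * iter n (ruelle w p) f x)).
    apply: (@supnorm_cvg0_pointwise _ _ K
      (fun n x => rh ^- n * iter n (ruelle w p) f x - pairing K mu' f * h' x)) => //.
      move=> n.
      have [] : BUC K dist (fun x => rh ^- n * iter n (ruelle w p) f x +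
          (- pairing K mu' f) * h' x) => //.
        by apply: BUCD; apply: (BUCZ Kx1); [exact: BT|exact/(CK_BUC cK)].
      by move=> [M hM] _; exists M => y Ky; rewrite -mulNr; exact: hM.
    exact: cvg'.
  move=> eta eta0; have [N hN] := cvg f ((CK_BUC cK f).1 Cf) eta eta0.
  by exists N => n Nn; exact: hN.
have C1 : CK K (fun=> 1) by apply/(CK_BUC cK)/BUC_cst.
(* Take [f = 1], on which [mu'] and [la] both have the value 1. Once [h'] is [h], dividing by [h x1]
   shows that [mu'] represents [la]. *)
have hh x : K x -> h' x = h x.
  move=> Kx; have := lim _ x C1 Kx; rewrite la1 mul1r => <-.
  rewrite /pairing Rintegral_cst; last exact: borel_compact.
  have -> : fine (mu' K) = 1 by rewrite muK'.
  by rewrite mulr1 mul1r.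
split; first by move=> x; rewrite inE; exact: hh.
move=> A mA; apply: riesz_unique => // f /(CK_BUC cK) Cf.
have := lim f x1 Cf Kx1; rewrite hh// => /mulIf; apply.
by rewrite gt_eqF// h_gt0.
Qed.
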